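(* Let $X$ and $Y$ be complex Banach spaces and let $T, S \in \mathcal{L}(X,Y)$ be such that $T$ is Fredholm and $\dim N(T-\lambda S)$ is constant in a neighborhood of $\lambda = 0$. Let $d(T;S)$ be the stability radius of $T$ and $S$, which equals the supremum of all $r>0$ such that $\dim N(T-\lambda S)$ and $\operatorname{codim} R(T-\lambda S)$ are constant for all $\lambda \in \mathbb{C}$ with $|\lambda|<r$. Then $$d(T;S) = \sup\left\{\frac{1}{r(SL)} : L \in \mathcal{L}(Y,X),\ TLT = T\right\} = \sup\left\{\frac{1}{r(SL)} : L \in \mathcal{L}(Y,X),\ TLT = T,\ LTL = L\right\}.$$
   Context: $\mathcal{L}(X,Y)$ is the Banach space of bounded linear operators from $X$ to $Y$. $N(A)$ and $R(A)$ denote the kernel and range of an operator $A$. An operator $A\in\mathcal{L}(X,Y)$ is Fredholm if both $\dim N(A)$ and $\operatorname{codim} R(A)$ are finite. For a bounded operator $A$ on a Banach space, $r(A)$ denotes its spectral radius. The suprema are taken in $[0,\infty]$, with the convention $1/0=\infty$ (both $d(T;S)$ and the suprema may be $\infty$). *)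

(* Defs.v *)
From mathcomp Require Import all_boot all_order all_algebra.
From mathcomp Require Import complex.
From mathcomp Require Import all_classical all_reals ereal topology normedtype.

Set Implicit Arguments.
Unset Strict Implicit.
Unset Printing Implicit Defensive.

Import Order.TTheory GRing.Theory Num.Theory.
Import numFieldNormedType.Exports.

Local Open Scope classical_set_scope.
Local Open Scope ring_scope.
Local Open Scope complex_scope.

Definition cmod (R : realType) (z : R[i]) : R := ComplexField.Normc.normc z.

(* Supremum in [0, +oo]: the supremum of the empty set is 0, not -oo. *)
Definition nnsup (R : realType) (A : set (\bar R)) : \bar R :=
  maxe 0%E (ereal_sup A).

Definition bounded_op (R : realType) (V W : normedModType R[i])
    (f : V -> W) : Prop :=
  exists M : R, forall x : V, `|f x| <= M%:C * `|x|.

(* For linear subspaces W `<=` U, the classes of the b i form a basis of the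
   quotient space U / W. *)
Definition quotient_basis (K : fieldType) (V : lmodType K) (U W : set V)
    (n : nat) (b : 'I_n -> V) : Prop :=
  (forall i, U (b i)) /\
  (forall u, U u -> exists! c : 'rV[K]_n, W (u - \sum_(i < n) c 0 i *: b i)).

(* The dimension of U / W; None means that it is infinite. *)
Definition quotient_dim (K : fieldType) (V : lmodType K) (U W : set V) :
    option nat :=
  xget None [set Some n | n in
    [set n : nat | exists b : 'I_n -> V, quotient_basis U W b]].

Definition space_dim (K : fieldType) (V : lmodType K) (U : set V) : option nat :=
  quotient_dim U [set 0].

Definition space_codim (K : fieldType) (V : lmodType K) (W : set V) : option nat :=
  quotient_dim [set: V] W.

Definition null_space (V W : zmodType) (f : V -> W) : set V := f @^-1` [set 0].

Definition fredholm (K : fieldType) (V W : lmodType K) (f : V -> W) : Prop :=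
  space_dim (null_space f) <> None /\ space_codim (range f) <> None.

Definition spectrum (R : realType) (V : normedModType R[i]) (A : V -> V) :
    set R[i] :=
  [set lambda | ~ exists B : {linear V -> V},
     [/\ bounded_op B,
         forall v, B (lambda *: v - A v) = v
       & forall v, lambda *: B v - A (B v) = v]].

Definition spectral_radius (R : realType) (V : normedModType R[i])
    (A : V -> V) : \bar R :=
  nnsup [set (cmod lambda)%:E | lambda in spectrum A].

Definition disc (R : realType) (r : R) : set R[i] := [set z | cmod z < r].

Definition constant_on (A B : Type) (D : set A) (f : A -> B) : Prop :=
  forall x y, D x -> D y -> f x = f y.

Definition pencil (K : fieldType) (V W : lmodType K) (T S : V -> W)
    (lambda : K) : V -> W :=
  fun x => T x - lambda *: S x.

Definition stability_radius (R : realType) (X Y : normedModType R[i])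
    (T S : X -> Y) : \bar R :=
  nnsup [set r%:E | r in [set r : R | [/\ 0 < r,
    constant_on (disc r)
      (fun lambda => space_dim (null_space (pencil T S lambda)))
  & constant_on (disc r)
      (fun lambda => space_codim (range (pencil T S lambda)))]]].

Definition inner_inverse (R : realType) (X Y : normedModType R[i])
    (T : X -> Y) : set {linear Y -> X} :=
  [set L : {linear Y -> X} | bounded_op L /\ forall x, T (L (T x)) = T x].

Definition reflexive_inverse (R : realType) (X Y : normedModType R[i])
    (T : X -> Y) : set {linear Y -> X} :=
  inner_inverse T `&` [set L : {linear Y -> X} | forall y, L (T (L y)) = L y].

(* Main.v *)
Require Import Defs.
From HB Require Import structures.
From mathcomp Require Import all_boot all_order all_algebra.
From mathcomp Require Import perm complex.
From mathcomp Require Import all_classical all_reals ereal topology normedtype.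
From mathcomp Require Import ring lra.

Set Implicit Arguments.
Unset Strict Implicit.
Unset Printing Implicit Defensive.

Import Order.TTheory GRing.Theory Num.Theory.
Import numFieldNormedType.Exports.

Local Open Scope classical_set_scope.
Local Open Scope ring_scope.
Local Open Scope complex_scope.

(** Write T_l = T - l S, let L be a bounded inner inverse of T, and put A = S L.
If I - l A has the inverse Q, then Psi = I + l L Q S inverts I - l L S, every
vector of ker T_l is Psi of a vector of ker T, and on ker T

    T_l Psi u = - l (I - T L) Q S u.

Call l regular when this vanishes for all u in ker T.  At a regular l one has
ker T_l = Psi (ker T) and ran T_l = (I - l A) (ran T), so that nullity and
codimension at l are those at 0, and L Q is an inner inverse of T_l
([pencil_kernel_basis], [pencil_range_basis], [pencil_inner_inverse]).
Conversely, equality of the finite nullities at 0 and at l forces regularity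
([pencil_regular_of_dim]).

Why 1 / r(S L) <= d.  By hypothesis the points near 0 are regular.  The map
l |-> (I - T L) (I - l A)^-1 S u is analytic where the resolvent exists, so it
keeps vanishing up to the modulus 1 / r(S L): its vanishing near 0 says that
S u lies in the closed subspace of the z with (I - T L) A^n z = 0 for all n,
and this subspace is invariant under the resolvents, as one sees by moving
from 0 in small steps
([germ_vanishes], [analytic_continuation]).

Why d is reached.  Let nullity and codimension be constant for |l| < r and let
rho < r.  Suppose that finitely many functionals f_i and vectors y_i are such
that, for every |l| <= rho at once, the common kernel of the f_i is a
complement of ker T_l and the span of the y_i is a complement of ran T_l.
Solving T_l x + sum_i c_i y_i = z, f_i(x) = 0 for (x, c) defines a bounded
reflexive inverse x = L_l z of T_l.  As the f_i and y_i do not depend on l,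
the L_l satisfy a resolvent identity, and I + l S L_l inverts I - l S L_0.
Hence r(S L_0) <= 1 / rho ([bordered_inverse], [steered_inverse]).

Such f_i and y_i are found by removing zeros ([steering]).  For a family that
is a basis modulo the relevant subspace at 0, the failures are the zeros of a
determinant.  If a combination phi of the family falls into the subspace at
l1, then phi is congruent to (l - l1) psi modulo the subspace at every l: a
functional phi which kills ker T_l1 is g o T_l1, and psi = g o S; a vector
phi = T_l1 x has psi = S x.  Exchanging one member of the family for psi
divides the determinant by l - l1 and creates no new zero.  Inner inverses of
T_l are bounded uniformly on |l| <= rho by compactness
([uniform_inner_inverse]), and so psi is controlled by phi.  Close to a point
where the determinant is nonzero, each exchange at least doubles the quotient
of that determinant by the product of the bounds of the family, which a
Hadamard-type estimate keeps bounded; so the exchanges stop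
([clear_around]).  Finitely many small discs then sweep the disc of radius
rho.

The functional analysis behind all this is the extension of functionals
([hahn_banach_functional]), which complements the kernel of a Fredholm
operator, and the open mapping theorem ([open_mapping]), which makes the
resulting inverses bounded. *)

(** * The modulus of a complex number *)
Local Notation Re := complex.Re.
Local Notation Im := complex.Im.

Section ComplexModulus.
Variable R : realType.
Implicit Types z w : R[i].

Lemma cmod_norm z : `|z| = (cmod z)%:C.
Proof. by []. Qed.

Lemma cmod_ge0 z : 0 <= cmod z.
Proof. by rewrite -lecR -cmod_norm normr_ge0. Qed.

Lemma cmodM z w : cmod (z * w) = cmod z * cmod w.
Proof. exact: ComplexField.Normc.normcM. Qed.

Lemma cmodD z w : cmod (z + w) <= cmod z + cmod w.
Proof. exact: le_normcD. Qed.

Lemma cmodN z : cmod (- z) = cmod z.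
Proof. by case: z => a b; rewrite /cmod /= !sqrrN. Qed.

Lemma cmodC z w : cmod (z - w) = cmod (w - z).
Proof. by rewrite -cmodN opprB. Qed.

Lemma cmod0 : cmod (0 : R[i]) = 0.
Proof. exact: ComplexField.Normc.normc0. Qed.

Lemma cmod1 : cmod (1 : R[i]) = 1.
Proof. exact: ComplexField.Normc.normc1. Qed.

Lemma cmod_eq0 z : cmod z = 0 -> z = 0.
Proof. exact: ComplexField.Normc.eq0_normc. Qed.

Lemma cmod_gt0 z : z != 0 -> 0 < cmod z.
Proof.
move=> z0; rewrite lt_neqAle cmod_ge0 andbT eq_sym.
by apply: contra_neq z0 => /cmod_eq0.
Qed.

Lemma cmodV z : cmod z^-1 = (cmod z)^-1.
Proof. exact: ComplexField.Normc.normcV. Qed.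

Lemma cmod_real (r : R) : cmod r%:C = `|r|.
Proof. by rewrite /cmod /= expr0n /= addr0 sqrtr_sqr. Qed.

Lemma cmod_i : cmod ('i%C : R[i]) = 1.
Proof. by rewrite /cmod /= expr0n /= add0r expr1n sqrtr1. Qed.

Lemma Re_le_cmod z : `|Re z| <= cmod z.
Proof. by rewrite -lecR; exact: normc_ge_Re. Qed.

Lemma Im_le_cmod z : `|Im z| <= cmod z.
Proof.
by have := Re_le_cmod (z * 'i%C); rewrite ReiNIm normrN cmodM cmod_i mulr1.
Qed.

Lemma cmod_le_ReIm z : cmod z <= `|Re z| + `|Im z|.
Proof.
rewrite {1}[z]complexE (le_trans (cmodD _ _))// cmodM cmod_i mul1r.
by rewrite !cmod_real.
Qed.

Lemma cmod_sum (I : finType) (F : I -> R[i]) :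
  cmod (\sum_i F i) <= \sum_i cmod (F i).
Proof.
elim/big_ind2: _ => [|x a y b xa yb|//]; first by rewrite cmod0.
by rewrite (le_trans (cmodD _ _)) ?lerD.
Qed.

Lemma cmod_prod (I : finType) (F : I -> R[i]) :
  cmod (\prod_i F i) = \prod_i cmod (F i).
Proof.
elim/big_ind2: _ => [|x a y b <- <-|//]; first by rewrite cmod1.
exact: cmodM.
Qed.

End ComplexModulus.

Lemma linear_fun_of (K : comNzRingType) (V W : lmodType K) (f : V -> W) :
  linear f -> exists g : {linear V -> W}, forall x, g x = f x.
Proof.
move=> lf; pose m := GRing.isLinear.Build K V W *:%R f lf.
pose g : {linear V -> W} := HB.pack f m.
by exists g.
Qed.

(** * Norms and the open mapping theorem *)
Lemma half_double (R : realType) (V : lmodType R[i]) (z : V) :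
  2^-1%:C *: (z + z) = z.
Proof.
rewrite -mulr2n -[z *+ 2]scaler_nat scalerA.
rewrite -[X in _ * X](rmorph_nat (real_complex R)) -rmorphM.
by rewrite mulVf ?scale1r// pnatr_eq0.
Qed.

Section AbstractNorm.
Variable R : realType.

Definition is_norm (V : lmodType R[i]) (N : V -> R) :=
  [/\ forall x y, N (x + y) <= N x + N y,
      forall a x, N (a *: x) = cmod a * N x
    & forall x, N x = 0 -> x = 0].

(** Completeness, tested only on sequences whose increments decay
geometrically; all limits taken below are of this kind, and the test passes to
products without filters. *)
Definition rapid_complete (V : lmodType R[i]) (N : V -> R) :=
  forall (u : nat -> V) (b : R),
    (forall k, N (u k.+1 - u k) <= b / 2 ^+ k) ->
    exists l B, forall k, N (l - u k) <= B / 2 ^+ k.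

Definition opb (V W : lmodType R[i]) (NV : V -> R) (NW : W -> R)
    (f : V -> W) (M : R) := forall x, NW (f x) <= M * NV x.

Section Norm.
Variables (V : lmodType R[i]) (N : V -> R).
Hypothesis nN : is_norm N.

Lemma norm_triangle x y : N (x + y) <= N x + N y. Proof. by case: nN. Qed.
Lemma norm_scale a x : N (a *: x) = cmod a * N x. Proof. by case: nN. Qed.
Lemma norm_separates x : N x = 0 -> x = 0. Proof. by case: nN => _ _; exact. Qed.

Lemma norm_zero : N 0 = 0.
Proof. by rewrite -(scale0r (0 : V)) norm_scale cmod0 mul0r. Qed.

Lemma norm_opp x : N (- x) = N x.
Proof. by rewrite -scaleN1r norm_scale cmodN cmod1 mul1r. Qed.

Lemma norm_nonneg x : 0 <= N x.
Proof. by have := norm_triangle x (- x); rewrite subrr norm_zero norm_opp; lra. Qed.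

Lemma norm_sub x y : N (x - y) <= N x + N y.
Proof. by rewrite -(norm_opp y) norm_triangle. Qed.

Lemma norm_subC x y : N (x - y) = N (y - x).
Proof. by rewrite -norm_opp opprB. Qed.

Lemma norm_dist x y z : N (x - z) <= N (x - y) + N (y - z).
Proof. by rewrite -(subrKA y x (- z)) norm_triangle. Qed.

Lemma norm_small_eq0 x : (forall e, 0 < e -> N x <= e) -> x = 0.
Proof.
move=> h; apply: norm_separates; apply/eqP; rewrite eq_le norm_nonneg andbT.
by apply/ler_addgt0Pl => e /h; rewrite addr0.
Qed.

Lemma norm_sum_le (I : finType) (F : I -> V) : N (\sum_i F i) <= \sum_i N (F i).
Proof.
elim/big_ind2: _ => [|x a y b xa yb|//]; first by rewrite norm_zero.
by rewrite (le_trans (norm_triangle _ _)) ?lerD.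
Qed.

End Norm.

Lemma half_pow_small (B e : R) : 0 < e -> exists k, B / 2 ^+ k <= e.
Proof.
move=> e0; have [k hk] : exists k : nat, B / e <= k%:R.
  exists (Num.bound (`|B / e|)); apply: le_trans (ler_norm _) _.
  by apply: ltW; apply: archi_boundP.
exists k; rewrite ler_pdivrMr ?exprn_gt0// mulrC -ler_pdivrMr//.
by rewrite (le_trans hk)// -natrX ler_nat ltnW// ltn_expl.
Qed.

Section Approx.
Variables (V W : lmodType R[i]) (NV : V -> R) (NW : W -> R).
Hypotheses (nV : is_norm NV) (nW : is_norm NW) (cV : rapid_complete NV).
Variable (T : {linear V -> W}) (M : R).
Hypothesis bT : opb NV NW T M.

(** Iterating on the residual r, which is halved each time, and summing the
corrections.  With h(y) = y this is the Neumann series; with h from the Baire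
argument it is the second half of the open mapping theorem. *)
Lemma approximate_solution (k : R) :
  0 <= k ->
  (forall y, exists x, NV x <= k * NW y /\ NW (y - T x) <= NW y / 2) ->
  forall y, exists x, T x = y /\ NV x <= 2 * k * NW y.
Proof.
move=> k0 /choice[h hP] y.
(* r n is the residual after n corrections, u n the sum of the corrections. *)
pose r := fix r n := if n is m.+1 then r m - T (h (r m)) else y.
pose u := fix u n := if n is m.+1 then u m + h (r m) else 0.
have rle n : NW (r n) <= NW y / 2 ^+ n.
  elim: n => [|n IH] /=; first by rewrite expr0 divr1.
  apply: le_trans (hP _).2 _; rewrite exprSr invfM mulrA ler_pM2r//.
have Tu n : T (u n) = y - r n.
  elim: n => [|n IH] /=; first by rewrite linear0 subrr.
  by rewrite linearD IH opprB addrA [in RHS]addrAC.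
have du n : NV (u n.+1 - u n) <= k * NW y / 2 ^+ n.
  rewrite /= addrC addKr; apply: le_trans (hP _).1 _.
  by rewrite -mulrA ler_wpM2l.
have [l [B lB]] := cV du.
have ule n : NV (u n) <= 2 * k * NW y - 2 * k * NW y / 2 ^+ n.
  elim: n => [|n IH]; first by rewrite /= (norm_zero nV) expr0 divr1 subrr.
  rewrite -[u n.+1](subrK (u n)); apply: le_trans (norm_triangle nV _ _) _.
  apply: le_trans (lerD (du n) IH) _.
  rewrite exprSr invfM; set a := (2 ^+ n)^-1.
  by lra.
exists l; split.
  apply/eqP; rewrite -subr_eq0; apply/eqP; apply: (norm_small_eq0 nW) => e e0.
  have [n hn] := half_pow_small (`|M| * B + NW y) e0.
  have -> : T l - y = T (l - u n) - r n.
    by rewrite linearB Tu opprB addrA [in RHS]addrAC addrK.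
  apply: le_trans hn; apply: le_trans (norm_sub nW _ _) _.
  rewrite mulrDl lerD//; apply: le_trans (bT _) _.
  rewrite -mulrA; apply: (@le_trans _ _ (`|M| * NV (l - u n))).
    by rewrite ler_wpM2r ?ler_norm ?(norm_nonneg nV).
  by rewrite ler_wpM2l.
apply/ler_addgt0Pl => e e0; have [n hn] := half_pow_small B e0.
rewrite -[l](subrK (u n)); apply: le_trans (norm_triangle nV _ _) _.
rewrite lerD ?(le_trans (lB n))// (le_trans (ule n))// gerBl.
by rewrite !mulr_ge0 ?(norm_nonneg nW)// invr_ge0 exprn_ge0.
Qed.

End Approx.

Section OpenMapping.
Variables (V W : lmodType R[i]) (NV : V -> R) (NW : W -> R).
Hypotheses (nV : is_norm NV) (nW : is_norm NW).
Hypotheses (cV : rapid_complete NV) (cW : rapid_complete NW).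
Variable (T : {linear V -> W}) (M : R).
Hypotheses (bT : opb NV NW T M) (sT : forall y, exists x, T x = y).

(** y is in the closure of the image of the ball of radius n. *)
Let near_image (n : nat) (y : W) :=
  forall e, 0 < e -> exists x, NV x <= n%:R /\ NW (y - T x) < e.

(** The Baire step.  If no closure had interior, one could choose nested balls
B(y_k, 2 d_k), the one of index k + 1 missing the image of the ball of radius
k; the common point of these balls would have no preimage. *)
Lemma image_somewhere_dense :
  exists n y d, 0 < d /\ forall z, NW (z - y) <= d -> near_image n z.
Proof.
apply: contrapT => H.
have step (p : nat * (W * R)) : exists q : W * R, 0 < p.2.2 ->
    [/\ NW (q.1 - p.2.1) <= p.2.2, 0 < q.2, q.2 <= p.2.2 / 2
      & forall z x, NW (z - q.1) <= 2 * q.2 -> NV x <= p.1%:R -> T x <> z].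
  case: p => n [y d] /=; have [d0|] := boolP (0 < d); last by exists (0, 0).
  apply: contrapT => Hq; apply: H; exists n, y, d; split=> // z zd e e0.
  apply: contrapT => Hx; apply: Hq; exists (z, Num.min (e / 4) (d / 2)) => _ /=.
  split=> //; rewrite ?ge_min ?lexx ?orbT ?lt_min ?divr_gt0//.
  move=> w x we xn Tx; apply: Hx; exists x; split=> //.
  rewrite Tx (norm_subC nW) (le_lt_trans we)//.
  have : Num.min (e / 4) (d / 2) <= e / 4 by rewrite ge_min lexx.
  lra.
have [g gP] := choice step.
pose s := fix s n := if n is m.+1 then g (m, s m) else (0 : W, 1 : R).
have s0 n : 0 < (s n).2 /\ (s n).2 <= 1 / 2 ^+ n.
  elim: n => [|n [IH1 IH2]]; first by rewrite /= expr0 divr1; split.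
  have [] := gP (n, s n) IH1; rewrite -[g (n, s n)]/(s n.+1) /= => _ h1 h2 _.
  split=> //; apply: le_trans h2 _.
  by rewrite exprSr invfM mulrA ler_pM2r.
have ds n : NW ((s n.+1).1 - (s n).1) <= 1 / 2 ^+ n.
  by have [/le_trans + _ _ _] := gP (n, s n) (s0 n).1; apply; apply: (s0 n).2.
have [l [B lB]] := cW ds.
(* Telescoping, since each step moves by at most d_k and d_(k+1) <= d_k / 2. *)
have dist n k : NW ((s (n + k)%N).1 - (s n).1) <= 2 * (s n).2 - 2 * (s (n + k)%N).2.
  elim: k => [|k IH]; first by rewrite addn0 subrr (norm_zero nW) subrr.
  rewrite addnS; have [h1 _ h2 _] := gP ((n + k)%N, s (n + k)%N) (s0 _).1.
  move: h1 h2; rewrite -[g ((n + k)%N, s (n + k)%N)]/(s (n + k).+1) /= => h1 h2.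
  apply: le_trans (norm_dist nW _ (s (n + k)%N).1 _) _; lra.
have ls n : NW (l - (s n).1) <= 2 * (s n).2.
  apply/ler_addgt0Pl => e e0; have [k hk] := half_pow_small `|B| e0.
  apply: le_trans (norm_dist nW _ (s (n + k)%N).1 _) _; apply: lerD.
    apply: le_trans (lB _) _; apply: le_trans hk.
    apply: (@le_trans _ _ (`|B| / 2 ^+ (n + k))).
      by rewrite ler_wpM2r ?ler_norm// invr_ge0 exprn_ge0.
    rewrite ler_wpM2l// lef_pV2 ?posrE ?exprn_gt0//.
    by rewrite ler_eXn2l ?leq_addl// ltr1n.
  by apply: le_trans (dist n k) _; have [] := s0 (n + k)%N; lra.
have [x Tx] := sT l.
have [n xn] : exists n : nat, NV x <= n%:R.
  exists (Num.bound (NV x)); apply: ltW.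
  by apply: le_lt_trans (archi_boundP (norm_nonneg nV _)).
have [_ _ _ /(_ l x)] := gP (n, s n) (s0 n).1; rewrite -[g (n, s n)]/(s n.+1).
by move=> /(_ (ls _) xn) /(_ Tx).
Qed.

Theorem open_mapping :
  exists K, 0 <= K /\ forall y, exists x, T x = y /\ NV x <= K * NW y.
Proof.
have [n [y0 [d [d0 H]]]] := image_somewhere_dense.
have ball0 z : NW z <= d -> near_image n z.
  move=> zd e e0.
  (* z is half the difference of y0 + z and y0 - z. *)
  have [|x1 [b1 c1]] := H (y0 + z) _ e e0; first by rewrite addrC addKr.
  have [|x2 [b2 c2]] := H (y0 - z) _ e e0.
    by rewrite addrC addKr (norm_opp nW).
  exists (2^-1%:C *: (x1 - x2)); split.
    rewrite (norm_scale nV) cmod_real ger0_norm//.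
    by have := norm_sub nV x1 x2; lra.
  have -> : z - T (2^-1%:C *: (x1 - x2)) =
      2^-1%:C *: ((y0 + z - T x1) - (y0 - z - T x2)).
    have -> : (y0 + z - T x1) - (y0 - z - T x2) = z + z - (T x1 - T x2).
      by rewrite !opprD !opprK addrACA [y0 + z + _]addrACA subrr add0r.
    by rewrite linearZ linearB [in RHS]scalerBr half_double.
  rewrite (norm_scale nW) cmod_real ger0_norm//.
  by have := norm_sub nW (y0 + z - T x1) (y0 - z - T x2); lra.
pose k := n%:R / d.
have k0 : 0 <= k by rewrite divr_ge0// ltW.
have approx y : exists x, NV x <= k * NW y /\ NW (y - T x) <= NW y / 2.
  have [/norm_separates ->//|y_neq0] := eqVneq (NW y) 0.
    by exists 0; rewrite linear0 subrr (norm_zero nV) (norm_zero nW) mulr0 mul0r.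
  have y0' : 0 < NW y by rewrite lt_neqAle eq_sym y_neq0 (norm_nonneg nW).
  pose c := d / NW y; have c0 : 0 < c by rewrite divr_gt0.
  have cyd : NW (c%:C *: y) <= d.
    by rewrite (norm_scale nW) cmod_real gtr0_norm// divfK.
  have e0 : 0 < c * NW y / 2 by rewrite divr_gt0// mulr_gt0.
  have [x [xn xy]] := ball0 _ cyd _ e0.
  exists (c^-1%:C *: x); rewrite (norm_scale nV) cmod_real gtr0_norm ?invr_gt0//.
  split.
    have -> : k * NW y = c^-1 * n%:R.
      by rewrite /k /c invf_div mulrC mulrA mulrAC.
    by rewrite ler_pM2l ?invr_gt0.
  have -> : y - T (c^-1%:C *: x) = c^-1%:C *: (c%:C *: y - T x).
    by rewrite linearZ scalerBr scalerA -rmorphM mulVf ?gt_eqF// scale1r.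
  rewrite (norm_scale nW) cmod_real gtr0_norm ?invr_gt0//.
  by rewrite ler_pdivrMl// mulrA ltW.
exists (2 * k); split; first by rewrite mulr_ge0.
by move=> y; have [x [Tx xk]] := approximate_solution nV nW cV bT k0 approx y; exists x.
Qed.

End OpenMapping.
End AbstractNorm.

(** * Banach spaces with a real-valued norm *)
Section RealNorm.
Variable R : realType.

(** The norm of a space over R[i] has values in R[i]; rnorm has them in R. *)
Definition rnorm (X : normedModType R[i]) (x : X) : R := Re `|x|.

Lemma normr_rnorm (X : normedModType R[i]) (x : X) : `|x| = (rnorm x)%:C.
Proof. by rewrite RRe_real// normr_real. Qed.

Lemma rnorm_is_norm (X : normedModType R[i]) : is_norm (@rnorm X).
Proof.
split=> [x y|a x|x nx0].
- by rewrite -lecR rmorphD; have := ler_normD x y; rewrite !normr_rnorm.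
- by have := normrZ a x; rewrite !normr_rnorm cmod_norm -rmorphM => /complexI.
- by apply/normr0_eq0; rewrite normr_rnorm nx0.
Qed.

Definition opbound (X Y : normedModType R[i]) (f : X -> Y) (M : R) :=
  opb (@rnorm X) (@rnorm Y) f M.

Lemma bounded_opP (X Y : normedModType R[i]) (f : X -> Y) :
  bounded_op f <-> exists M, opbound f M.
Proof.
split=> -[M fM]; exists M => x.
  by have := fM x; rewrite !normr_rnorm -rmorphM lecR.
by rewrite !normr_rnorm -rmorphM lecR.
Qed.

Lemma rapid_dist (V : lmodType R[i]) (N : V -> R) (u : nat -> V) (b : R) :
  is_norm N -> (forall k, N (u k.+1 - u k) <= b / 2 ^+ k) ->
  forall n k, N (u (n + k)%N - u n) <= 2 * b / 2 ^+ n.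
Proof.
move=> nN ub n k.
have b0 : 0 <= b by have := ub 0%N; have := norm_nonneg nN (u 1%N - u 0%N); lra.
suff h : N (u (n + k)%N - u n) <= 2 * b / 2 ^+ n - 2 * b / 2 ^+ (n + k).
  apply: le_trans h _; rewrite gerBl !mulr_ge0// invr_ge0 exprn_ge0//.
elim: k => [|k IH]; first by rewrite addn0 !subrr (norm_zero nN).
rewrite addnS; apply: le_trans (norm_dist nN _ (u (n + k)%N) _) _.
apply: le_trans (lerD (ub _) IH) _.
rewrite exprSr invfM; set a := (2 ^+ (n + k))^-1; lra.
Qed.

Lemma rnorm_complete (X : completeNormedModType R[i]) : rapid_complete (@rnorm X).
Proof.
move=> u b ub; have nN := @rnorm_is_norm X.
have dist := rapid_dist nN ub.
have /cauchy_cvg /cvg_ex[l ul] : cauchy (u @ \oo).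
  apply/cauchy_exP => e e0.
  have eR : e = (Re e)%:C by rewrite RRe_real// gtr0_real.
  have e0' : 0 < Re e / 2 by rewrite divr_gt0// -ltcR -eR.
  have [n hn] := half_pow_small (2 * b) e0'.
  exists (u n); exists n => // m /= mn.
  rewrite -ball_normE /ball_/= normr_rnorm eR ltcR (norm_subC nN).
  rewrite -(subnKC mn) (le_lt_trans (dist n _))// (le_lt_trans hn)//.
  by move: e0'; lra.
exists l, (2 * b) => k.
apply/ler_addgt0Pl => e e0.
have /cvgrPdist_lt/(_ e%:C) := ul; rewrite ltcR => /(_ e0)[n _ hn].
apply: le_trans (norm_dist nN _ (u (k + n)%N) _) _; apply: lerD => //.
by have := hn (k + n)%N (leq_addl _ _); rewrite normr_rnorm ltcR => /ltW.
Qed.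

Lemma real_rapid_complete (u : nat -> R) (b : R) :
  (forall k, `|u k.+1 - u k| <= b / 2 ^+ k) ->
  exists l, forall k, `|l - u k| <= 2 * b / 2 ^+ k.
Proof.
move=> ub.
have b0 : 0 <= b.
  by have := ub 0%N; rewrite expr0 divr1; apply: le_trans.
pose e k := 2 * b / 2 ^+ k.
have dist n k : `|u (n + k)%N - u n| <= e n.
  suff h : `|u (n + k)%N - u n| <= e n - e (n + k)%N.
    apply: le_trans h _; rewrite gerBl !mulr_ge0// invr_ge0 exprn_ge0//.
  elim: k => [|k IH]; first by rewrite addn0 !subrr normr0.
  rewrite addnS; apply: le_trans (ler_distD (u (n + k)%N) _ _) _.
  apply: le_trans (lerD (ub _) IH) _.
  rewrite /e exprSr invfM; set a := (2 ^+ (n + k))^-1; lra.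
(* The intervals [u k - e k, u k + e k] meet pairwise, so the supremum of the
   left endpoints lies in all of them. *)
have cross j k : u j - e j <= u k + e k.
  have [jk|/ltnW kj] := leqP j k.
    have := dist j (k - j)%N; rewrite subnKC// ler_norml => /andP[+ _].
    have : 0 <= e k by rewrite /e !mulr_ge0// invr_ge0 exprn_ge0.
    lra.
  have := dist k (j - k)%N; rewrite subnKC// ler_norml => /andP[_].
  have : 0 <= e j by rewrite /e !mulr_ge0// invr_ge0 exprn_ge0.
  lra.
pose A := range (fun j => u j - e j).
have A0 : A !=set0 by exists (u 0%N - e 0%N), 0%N.
have Aub k : ubound A (u k + e k) by move=> _ [j _ <-].
exists (sup A) => k; rewrite ler_norml; apply/andP; split.
  have : u k - e k <= sup A.
    by apply: ub_le_sup; [exists (u 0%N + e 0%N) | exists k].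
  rewrite -/(e k); lra.
have : sup A <= u k + e k by apply: ge_sup.
rewrite -/(e k); lra.
Qed.

Lemma complex_rapid_complete (u : nat -> R[i]) (b : R) :
  (forall k, cmod (u k.+1 - u k) <= b / 2 ^+ k) ->
  exists l, forall k, cmod (l - u k) <= 4 * b / 2 ^+ k.
Proof.
move=> ub.
have [|a ha] := @real_rapid_complete (fun k => Re (u k)) b.
  move=> k /=; apply: le_trans (ub k); apply: le_trans (Re_le_cmod _).
  by rewrite raddfB.
have [|c hc] := @real_rapid_complete (fun k => Im (u k)) b.
  move=> k /=; apply: le_trans (ub k); apply: le_trans (Im_le_cmod _).
  by rewrite raddfB.
exists (a +i* c) => k; apply: le_trans (cmod_le_ReIm _) _.
move: (ha k) (hc k); rewrite !raddfB /= => h1 h2.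
by apply: le_trans (lerD h1 h2) _; rewrite -mulrDl -mulrDl -natrD.
Qed.

Section RowExtension.
Variables (X : completeNormedModType R[i]) (m : nat).

(** Bordering an operator replaces X by X x C^m, with this norm. *)
Definition ext_norm (p : X * 'rV[(R[i])]_m) : R :=
  rnorm p.1 + \sum_i cmod (p.2 0 i).

Lemma rnorm_le_ext p : rnorm p.1 <= ext_norm p.
Proof. by rewrite lerDl sumr_ge0// => i _; exact: cmod_ge0. Qed.

Lemma coord_le_ext (p : X * 'rV[(R[i])]_m) i : cmod (p.2 0 i) <= ext_norm p.
Proof.
rewrite /ext_norm (bigD1 i)//= addrCA lerDl addr_ge0 ?(norm_nonneg (@rnorm_is_norm X))//.
by rewrite sumr_ge0// => j _; exact: cmod_ge0.
Qed.

Lemma ext_is_norm : is_norm ext_norm.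
Proof.
have nN := @rnorm_is_norm X; split=> [x y|a x|x x0].
- rewrite /ext_norm addrACA lerD ?(norm_triangle nN)// -big_split ler_sum// => i _.
  by rewrite mxE cmodD.
- rewrite /ext_norm (norm_scale nN) mulrDr mulr_sumr; congr (_ + _).
  by apply: eq_bigr => i _; rewrite mxE cmodM.
- case: x x0 => x c x0.
  have xz : rnorm x <= 0 by rewrite -x0 (rnorm_le_ext (x, c)).
  congr (_, _).
    by apply: (norm_separates nN); apply/eqP; rewrite eq_le xz (norm_nonneg nN).
  apply/rowP => i; rewrite mxE; apply: cmod_eq0; apply/eqP.
  by rewrite eq_le cmod_ge0 andbT -x0 (coord_le_ext (x, c)).
Qed.

Lemma ext_complete : rapid_complete ext_norm.
Proof.
move=> u b ub.
have [|l [B lB]] := @rnorm_complete X (fun k => (u k).1) b.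
  by move=> k; apply: le_trans (ub k); exact: (rnorm_le_ext (u k.+1 - u k)).
have ci i : exists c, forall k, cmod (c - (u k).2 0 i) <= 4 * b / 2 ^+ k.
  apply: complex_rapid_complete => k; apply: le_trans (ub k).
  by have := coord_le_ext (u k.+1 - u k) i; rewrite !mxE.
have [c cP] := choice ci.
exists (l, \row_i c i), (B + \sum_(i < m) 4 * b) => k.
rewrite /ext_norm mulrDl; apply: lerD; first exact: lB.
rewrite mulr_suml ler_sum// => i _.
by rewrite !mxE.
Qed.

End RowExtension.

Section Neumann.
Variable X : completeNormedModType R[i].
Local Notation N := (@rnorm X).

(** The bound 2 comes from |x| <= |x - B x| + |x| / 2, which also gives
injectivity. *)
Lemma neumann (B : {linear X -> X}) :
  opbound B (1 / 2) ->
  exists G : {linear X -> X}, [/\ forall x, G (x - B x) = x,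
    forall x, G x - B (G x) = x & opbound G 2].
Proof.
move=> hB; have nN := @rnorm_is_norm X.
have lI : linear (fun x => x - B x).
  by move=> a x y; rewrite linearP scalerBr opprD addrACA.
have [I IE] := linear_fun_of lI.
have low x : N x <= 2 * N (I x).
  have := norm_triangle nN (I x) (B x); rewrite {1}IE addrNK.
  by have := hB x; lra.
have bI : opbound I (3 / 2).
  by move=> x; rewrite IE; have := norm_sub nN x (B x); have := hB x; lra.
have surj y : exists x, I x = y.
  have [|x [Ix _]] := approximate_solution nN nN (@rnorm_complete X) bI
    ler01 _ y; last by exists x.
  move=> z; exists z; rewrite mul1r IE opprB addrCA subrr addr0.
  by split=> //; have := hB z; lra.
have inj x y : I x = I y -> x = y.
  move=> Ixy; apply/eqP; rewrite -subr_eq0; apply/eqP; apply: (norm_separates nN).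
  apply/eqP; rewrite eq_le (norm_nonneg nN) andbT; apply: le_trans (low _) _.
  by rewrite linearB Ixy subrr (norm_zero nN) mulr0.
have [g gP] := choice surj.
have lg : linear g by move=> a x y; apply: inj; rewrite linearP !gP.
have [G GE] := linear_fun_of lg.
exists G; split=> x; rewrite ?GE.
- by apply: inj; rewrite gP IE.
- by rewrite -IE gP.
- by have := low (g x); rewrite gP.
Qed.

End Neumann.

End RealNorm.

(** * The Hahn-Banach theorem *)
Section HahnBanach.
Variable R : realType.

Definition sublinear (V : lmodType R[i]) (q : V -> R) :=
  (forall x y, q (x + y) <= q x + q y) /\
  (forall (r : R) x, 0 <= r -> q (r%:C *: x) <= r * q x).

Section Sublinear.
Variable V : lmodType R[i].
Implicit Types (q : V -> R) (x y : V).

Lemma sublinear0 q : sublinear q -> q 0 = 0.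
Proof.
move=> [qD qZ]; apply/eqP; rewrite eq_le.
have := qZ 0 0 (lexx _); rewrite scaler0 mul0r => -> /=.
by have := qD 0 0; rewrite addr0; lra.
Qed.

Lemma sublinearN q x : sublinear q -> - q (- x) <= q x.
Proof.
move=> sq; have := sq.1 x (- x); rewrite subrr (sublinear0 sq); lra.
Qed.

Lemma sublinearZ q (r : R) x : sublinear q -> 0 <= r -> q (r%:C *: x) = r * q x.
Proof.
move=> sq; rewrite le_eqVlt => /orP[/eqP<-|r0].
  by rewrite mul0r scale0r (sublinear0 sq).
apply/eqP; rewrite eq_le (sq.2 _ _ (ltW r0))/= -ler_pdivlMl//.
have {1}-> : x = r^-1%:C *: (r%:C *: x).
  by rewrite scalerA -rmorphM mulVf ?scale1r// gt_eqF.
by apply: sq.2; rewrite invr_ge0 ltW.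
Qed.

(** q' x = inf_(t >= 0) (q (x + t y) - t q y).  A minimal sublinear functional
equals all its shifts, hence is odd; and shifting before minimizing fixes the
value of the linear functional at y. *)
Lemma sublinear_shift q y : sublinear q ->
  exists q', [/\ sublinear q', forall x, q' x <= q x & q' (- y) <= - q y].
Proof.
move=> sq.
pose S x := [set q (x + t%:C *: y) - t * q y | t in [set t : R | 0 <= t]].
have lb x : lbound (S x) (- q (- x)).
  move=> _ [t t0 <-]; rewrite lerBrDl -(sublinearZ _ sq t0) lerBlDr.
  by apply: le_trans (sq.1 _ _); rewrite addrAC subrr add0r.
have hlb x : has_lbound (S x) by exists (- q (- x)).
have S0 x : S x !=set0 by exists (q (x + 0%:C *: y) - 0 * q y), 0 => /=.
pose q' x := inf (S x).
have le x t : 0 <= t -> q' x <= q (x + t%:C *: y) - t * q y.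
  by move=> t0; apply: ge_inf => //; exists t.
exists q'; split.
- split=> [x x'|r x r0].
    rewrite -lerBlDr; apply: lb_le_inf => // _ [t t0 <-].
    rewrite lerBlDr -lerBlDl; apply: lb_le_inf => // _ [t' t'0 <-].
    rewrite lerBlDl; apply: le_trans (le _ (t + t') (addr_ge0 t0 t'0)) _.
    have := sq.1 (x + t%:C *: y) (x' + t'%:C *: y).
    by rewrite addrACA -scalerDl -rmorphD; lra.
  move: r0; rewrite le_eqVlt => /orP[/eqP<-|r0].
    apply: le_trans (le _ 0 (lexx _)) _.
    by rewrite !scale0r addr0 (sublinear0 sq) !mul0r subr0.
  rewrite -ler_pdivrMl//; apply: lb_le_inf => // _ [t t0 <-].
  rewrite ler_pdivrMl//; apply: le_trans (le _ (r * t) _) _.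
    by rewrite mulr_ge0// ltW.
  rewrite mulrBr mulrA lerD2r rmorphM -scalerA -scalerDr.
  by apply: sq.2; apply: ltW.
- move=> x; apply: le_trans (le _ 0 (lexx _)) _.
  by rewrite scale0r addr0 mul0r subr0.
- apply: le_trans (le _ 1 ler01) _.
  by rewrite scale1r addNr (sublinear0 sq) mul1r sub0r.
Qed.

(** Zorn's lemma, the pointwise infimum of a chain being sublinear. *)
Lemma minimal_sublinear p : sublinear p -> exists q,
  [/\ sublinear q, forall x, q x <= p x &
      forall q', sublinear q' -> (forall x, q' x <= q x) -> q' = q].
Proof.
move=> sp.
pose T := {q : V -> R | sublinear q /\ forall x, q x <= p x}.
pose le (s t : T) := `[< forall x, sval t x <= sval s x >].
have [||||[q [sq qp]] qmin] := @Zorn T le.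
- by move=> t; apply/asboolP.
- move=> r s t /asboolP rs /asboolP st; apply/asboolP => x.
  exact: le_trans (st x) (rs x).
- move=> s t /asboolP st /asboolP ts; apply: eq_sig_hprop.
    by move=> ? ? ?; exact: Prop_irrelevance.
  by apply/funext => x; apply/eqP; rewrite eq_le st ts.
- move=> A Atot; have [[s0 As0]|A0] := pselect (A !=set0); last first.
    exists (exist _ p (conj sp (fun x => lexx _))) => s As.
    by exfalso; apply: A0; exists s.
  pose S x := [set sval s x | s in A].
  have hlb x : has_lbound (S x).
    exists (- p (- x)) => _ [[q [sq qp]] _ <-] /=.
    by apply: le_trans (sublinearN x sq); rewrite lerN2.
  have S0 x : S x !=set0 by exists (sval s0 x), s0.
  pose m x := inf (S x).
  have ml s x : A s -> m x <= sval s x.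
    by move=> As; apply: ge_inf => //; exists s.
  have sm : sublinear m.
    split=> [x y|r x r0].
      rewrite -lerBlDr; apply: lb_le_inf => // _ [s As <-].
      rewrite lerBlDr -lerBlDl; apply: lb_le_inf => // _ [t At <-].
      rewrite lerBlDl; have [/asboolP st|/asboolP ts] := Atot _ _ As At.
        apply: le_trans (ml t _ At) _.
        apply: le_trans ((svalP t).1.1 x y) _.
        by rewrite lerD2r.
      apply: le_trans (ml s _ As) _.
      apply: le_trans ((svalP s).1.1 x y) _.
      by rewrite lerD2l.
    move: r0; rewrite le_eqVlt => /orP[/eqP<-|r0].
      apply: le_trans (ml s0 _ As0) _.
      by rewrite scale0r (sublinear0 (svalP s0).1) mul0r.
    rewrite -ler_pdivrMl//; apply: lb_le_inf => // _ [t At <-].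
    rewrite ler_pdivrMl//; apply: le_trans (ml t _ At) _.
    by apply: (svalP t).1.2; apply: ltW.
  have mp x : m x <= p x by apply: le_trans (ml _ _ As0) ((svalP s0).2 x).
  exists (exist _ m (conj sm mp)) => s As; apply/asboolP => x /=.
  exact: ml.
exists q; split=> // q' sq' q'q.
have q'p x : q' x <= p x by apply: le_trans (q'q x) (qp x).
have := qmin (exist _ q' (conj sq' q'p)).
by move=> h; have /(congr1 sval) := h (asboolT q'q).
Qed.

Lemma real_linear_below p : sublinear p -> exists u : V -> R,
  [/\ forall x y, u (x + y) = u x + u y,
      forall (r : R) x, u (r%:C *: x) = r * u x & forall x, u x <= p x].
Proof.
move=> /minimal_sublinear[u [su up umin]].
have uN y : u (- y) = - u y.
  have [q' [sq' q'u]] := sublinear_shift y su.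
  rewrite (umin _ sq' q'u) => h; apply/eqP; rewrite eq_le h/=.
  by rewrite -lerN2 opprK (sublinearN y su).
have uD x y : u (x + y) = u x + u y.
  apply/eqP; rewrite eq_le su.1/=.
  by have := su.1 (x + y) (- y); rewrite addrK uN; lra.
exists u; split=> // r x; have [r0|r0] := leP 0 r; first exact: sublinearZ.
have r0' : 0 <= - r by rewrite oppr_ge0 ltW.
have := sublinearZ x su r0'; rewrite rmorphN scaleNr uN; lra.
Qed.

(** A real-linear u below p gives the complex-linear u(x) - i u(i x), bounded by
2 p.  Stated for a seminorm p, so that the functional vanishes wherever p
does. *)
Theorem hahn_banach_functional p v :
  (forall x y, p (x + y) <= p x + p y) ->
  (forall a x, p (a *: x) = cmod a * p x) -> 0 < p v ->
  exists (f : V -> R[i]) (K : R), [/\ 0 <= K,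
    forall a x y, f (a *: x + y) = a * f x + f y,
    forall x, cmod (f x) <= K * p x & f v = 1].
Proof.
move=> pD pZ pv.
have sp : sublinear p.
  by split=> // r x r0; rewrite pZ cmod_real ger0_norm.
have pN x : p (- x) = p x by rewrite -scaleN1r pZ cmodN cmod1 mul1r.
have [p' [sp' p'p p'v]] := sublinear_shift v sp.
have [u [uD uZ up]] := real_linear_below sp'.
have uN x : u (- x) = - u x.
  by rewrite -scaleN1r -(rmorphN1 (real_complex R)) uZ mulN1r.
have ule x : `|u x| <= p x.
  rewrite ler_norml (le_trans (up _) (p'p _)) andbT lerNl -uN -pN.
  by rewrite (le_trans (up _) (p'p _)).
(* The shift made p' (- v) <= - p v, hence u v >= p v. *)
have uv : 0 < u v.
  by have := le_trans (up (- v)) p'v; rewrite uN; lra.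
pose f x : R[i] := u x +i* - u ('i%C *: x).
have fD x y : f (x + y) = f x + f y.
  by rewrite /f scalerDr !uD opprD.
have fr (r : R) x : f (r%:C *: x) = r%:C * f x.
  have -> : f (r%:C *: x) = u (r%:C *: x) +i* - u (r%:C *: ('i%C *: x)).
    by rewrite /f !scalerA [r%:C * _]mulrC.
  rewrite !uZ.
  by apply/eqP; rewrite eq_complex /= !mul0r !subr0 !addr0 mulrN !eqxx.
have fi x : f ('i%C *: x) = 'i%C * f x.
  rewrite /f scalerA -expr2 sqr_i scaleN1r uN opprK.
  by apply/eqP; rewrite eq_complex /= !mul0r !mul1r sub0r add0r opprK !eqxx.
have fZ a x : f (a *: x) = a * f x.
  by rewrite [a]complexE scalerDl fD fr -scalerA fi fr mulrDl mulrA.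
have fv : f v != 0.
  by apply/eqP => /(congr1 (@complex.Re R)) /= h; rewrite h ltxx in uv.
have fle x : cmod (f x) <= 2 * p x.
  apply: le_trans (cmod_le_ReIm _) _ => /=; rewrite normrN.
  by have := ule x; have := ule ('i%C *: x); rewrite pZ cmod_i; lra.
exists (fun x => f x / f v), (2 / cmod (f v)); split.
- by rewrite divr_ge0// cmod_ge0.
- by move=> a x y; rewrite fD fZ mulrDl mulrA.
- move=> x; rewrite cmodM cmodV mulrAC ler_pM2r//.
  by rewrite invr_gt0 cmod_gt0.
- by rewrite divff.
Qed.

End Sublinear.
End HahnBanach.

(** * Bounded functionals *)
Section BoundedFunctionals.
Variables (R : realType) (X : normedModType R[i]).
Local Notation C := (R[i]).

Definition functional (f : X -> C) (K : R) :=
  (forall a x y, f (a *: x + y) = a * f x + f y) /\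
  (forall x, cmod (f x) <= K * rnorm x).

Section Theory.
Variables (f : X -> C) (K : R).
Hypothesis fK : functional f K.

Lemma functional0 : f 0 = 0.
Proof. by have := fK.1 (-1) 0 0; rewrite scaler0 addr0 mulN1r addNr. Qed.

Lemma functionalD x y : f (x + y) = f x + f y.
Proof. by rewrite -[x]scale1r fK.1 scale1r mul1r. Qed.

Lemma functionalZ a x : f (a *: x) = a * f x.
Proof. by rewrite -[a *: x]addr0 fK.1 functional0 addr0. Qed.

Lemma functionalB x y : f (x - y) = f x - f y.
Proof. by rewrite -scaleN1r functionalD functionalZ mulN1r. Qed.

Lemma functional_sum (I : finType) (c : I -> C) (v : I -> X) :
  f (\sum_i c i *: v i) = \sum_i c i * f (v i).
Proof.
elim/big_ind2: _ => [|x a y b <- <-|i _]; first exact: functional0.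
  exact: functionalD.
exact: functionalZ.
Qed.

Lemma functional_bound_abs : functional f `|K|.
Proof.
split; first exact: fK.1.
move=> x; apply: le_trans (fK.2 x) _.
by rewrite ler_wpM2r ?ler_norm// (norm_nonneg (@rnorm_is_norm _ _)).
Qed.

End Theory.

Lemma functional_lincomb f K g L a : functional f K -> functional g L ->
  functional (fun x => f x + a * g x) (K + cmod a * L).
Proof.
move=> fK gL; split=> [b x y|x].
  by rewrite fK.1 gL.1; ring.
apply: le_trans (cmodD _ _) _; rewrite cmodM mulrDl lerD ?fK.2//.
by rewrite -mulrA ler_wpM2l ?cmod_ge0 ?gL.2.
Qed.

(** Induction on k.  The functionals dual to all vectors but one define a
projection P onto their span, and x |-> |x - P x| is a seminorm which vanishes
on that span and not at the remaining vector. *)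
Lemma dual_functionals k (v : 'I_k -> X) :
  (forall c : 'I_k -> C, \sum_i c i *: v i = 0 -> forall i, c i = 0) ->
  exists f : 'I_k -> X -> C, (forall i, exists K, functional (f i) K) /\
    forall i j, f i (v j) = (i == j)%:R.
Proof.
have nN := @rnorm_is_norm _ X.
elim: k v => [|k IH] v vfree; first by exists (fun _ _ => 0); split=> -[].
pose w j := v (lift ord0 j).
have [|f [fK fw]] := IH w.
  move=> c cw i.
  pose c' j := if unlift ord0 j is Some i then c i else 0.
  have := vfree c' _ (lift ord0 i); rewrite /c' liftK; apply.
  rewrite big_ord_recl unlift_none scale0r add0r -[RHS]cw.
  by apply: eq_bigr => j _; rewrite liftK.
have {fK} [K fK] := choice fK.
pose P x := \sum_i f i x *: w i.
have PD x y : P (x + y) = P x + P y.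
  by rewrite -big_split; apply: eq_bigr => i _; rewrite (functionalD (fK i)) scalerDl.
have PZ a x : P (a *: x) = a *: P x.
  rewrite scaler_sumr; apply: eq_bigr => i _.
  by rewrite (functionalZ (fK i)) scalerA.
pose p x := rnorm (x - P x).
have v0 : 0 < p (v ord0).
  rewrite lt_neqAle (norm_nonneg nN) andbT eq_sym; apply/eqP => /(norm_separates nN) v0.
  pose c' j := if unlift ord0 j is Some i then - f i (v ord0) else 1.
  have := vfree c' _ ord0; rewrite /c' unlift_none => h.
  suff /h/eqP : \sum_i c' i *: v i = 0 by rewrite oner_eq0.
  rewrite big_ord_recl /c' unlift_none scale1r -[RHS]v0 /P -sumrN.
  by congr (_ + _); apply: eq_bigr => j _; rewrite liftK scaleNr.
have [|||g [L [L0 gl gp gv]]] := @hahn_banach_functional _ X p (v ord0).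
- move=> x y; rewrite /p PD opprD addrACA; exact: norm_triangle nN _ _.
- by move=> a x; rewrite /p PZ -scalerBr (norm_scale nN).
- exact: v0.
have gw j : g (w j) = 0.
  apply: cmod_eq0; apply/eqP; rewrite eq_le cmod_ge0 andbT.
  apply: le_trans (gp _) _; rewrite /p /P (bigD1 j)//= fw eqxx scale1r.
  rewrite big1 ?addr0 ?subrr ?(norm_zero nN) ?mulr0// => i ij.
  by rewrite fw (negbTE ij) scale0r.
have Pb x : rnorm (P x) <= (\sum_i K i * rnorm (w i)) * rnorm x.
  rewrite mulr_suml; apply: le_trans (norm_sum_le nN _) _.
  apply: ler_sum => i _; rewrite (norm_scale nN) mulrAC.
  by rewrite ler_wpM2r ?(norm_nonneg nN) ?(fK i).2.
have gF : functional g (L * (1 + \sum_i K i * rnorm (w i))).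
  split=> // x; apply: le_trans (gp _) _; rewrite -mulrA ler_wpM2l//.
  apply: le_trans (norm_sub nN _ _) _; rewrite mulrDl mul1r lerD2l.
  exact: Pb.
(* The old functionals are corrected to vanish at the new vector. *)
pose f' i x := if unlift ord0 i is Some j then f j x + (- f j (v ord0)) * g x
               else g x.
exists f'; split.
  move=> i; rewrite /f'; case: unliftP => [j|] _.
    by eexists; exact: functional_lincomb (fK j) gF.
  by exists (L * (1 + \sum_i K i * rnorm (w i))).
move=> i j; rewrite /f'; case: (unliftP ord0 i) => [i'|] ->; rewrite ?liftK ?unlift_none.
  case: (unliftP ord0 j) => [j'|] ->.
    by rewrite -/(w j') gw mulr0 addr0 fw (inj_eq lift_inj).
  by rewrite gv mulr1 subrr -[_ == _]negbK eq_sym neq_lift.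
case: (unliftP ord0 j) => [j'|] ->; last by rewrite gv eqxx.
by rewrite -/(w j') gw -[_ == _]negbK neq_lift.
Qed.

End BoundedFunctionals.

(** * Dimension of a quotient *)
Section QuotientDimension.
Variable K : fieldType.

(** The two change of basis matrices A and A' satisfy A A' = 1, so that the rank
of the identity bounds the size. *)
Lemma quotient_basis_eq_size (V : lmodType K) (U W : set V) n m
    (b : 'I_n -> V) (b' : 'I_m -> V) :
  (forall a x y, W x -> W y -> W (a *: x + y)) ->
  quotient_basis U W b -> quotient_basis U W b' -> n = m.
Proof.
move=> Wlin.
have W0 x : W x -> W 0 by move=> Wx; rewrite -[0](addNr x) -scaleN1r; exact: Wlin.
have WD x y : W x -> W y -> W (x + y) by move=> Wx Wy; rewrite -[x]scale1r; exact: Wlin.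
have Wsum (I : finType) (F : I -> V) (x : V) : W x -> (forall i, W (F i)) -> W (\sum_i F i).
  by move=> /W0 Wx HF; elim/big_ind: _ => // i _; exact: HF.
have WZ a x : W x -> W (a *: x).
  by move=> Wx; rewrite -[a *: x]addr0; apply: Wlin => //; exact: W0 Wx.
suff le p q (d : 'I_p -> V) (d' : 'I_q -> V) :
    quotient_basis U W d -> quotient_basis U W d' -> (p <= q)%N.
  move=> hb hb'; apply/eqP; rewrite eqn_leq.
  by rewrite (le _ _ _ _ hb hb') (le _ _ _ _ hb' hb).
move=> [Ud hd] [Ud' hd'].
have /choice[c hc] i : exists c : 'rV[K]_q, W (d i - \sum_j c 0 j *: d' j).
  by have [c [hc _]] := hd' _ (Ud i); exists c.
have /choice[c' hc'] i : exists c : 'rV[K]_p, W (d' i - \sum_j c 0 j *: d j).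
  by have [c' [hc' _]] := hd _ (Ud' i); exists c'.
pose A := \matrix_(i < p, j < q) c i 0 j.
pose A' := \matrix_(i < q, j < p) c' i 0 j.
suff AA : A *m A' = 1%:M.
  by rewrite -(mxrank1 K p) -AA; apply: leq_trans (mxrankM_maxl _ _) (rank_leq_col _).
apply/row_matrixP => i; rewrite row1.
have [e [_ eu]] := hd _ (Ud i).
rewrite -(eu (delta_mx 0 i)); last first.
  rewrite (bigD1 i)//= mxE !eqxx scale1r big1 ?addr0 ?subrr.
    exact: W0 (hc i).
  by move=> j ji; rewrite mxE (negbTE ji) andbF scale0r.
apply/esym/eu.
have -> : d i - \sum_j row i (A *m A') 0 j *: d j =
  (d i - \sum_j c i 0 j *: d' j) +
    \sum_k c i 0 k *: (d' k - \sum_j c' k 0 j *: d j).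
  have -> : \sum_j row i (A *m A') 0 j *: d j =
      \sum_k c i 0 k *: \sum_j c' k 0 j *: d j.
    under eq_bigr => j _ do rewrite !mxE scaler_suml.
    rewrite exchange_big; apply: eq_bigr => k _; rewrite scaler_sumr.
    by apply: eq_bigr => j _; rewrite !mxE scalerA.
  rewrite -addrA; congr (_ + _).
  under [X in _ = _ + X]eq_bigr => k _ do rewrite scalerBr.
  by rewrite big_split addKr sumrN.
by apply: WD => //; apply: Wsum (hc i) _ => k; exact: WZ.
Qed.

Lemma quotient_dimE (V : lmodType K) (U W : set V) n (b : 'I_n -> V) :
  (forall a x y, W x -> W y -> W (a *: x + y)) ->
  quotient_basis U W b -> quotient_dim U W = Some n.
Proof.
move=> Wlin hb; rewrite /quotient_dim.
case: xgetP => [o -> [m [b' hb'] <-]|/(_ (Some n)) []].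
  by rewrite (quotient_basis_eq_size Wlin hb hb').
by exists n => //; exists b.
Qed.

Lemma quotient_dim_Some (V : lmodType K) (U W : set V) n :
  quotient_dim U W = Some n -> exists b : 'I_n -> V, quotient_basis U W b.
Proof.
by rewrite /quotient_dim; case: xgetP => [o -> [m [b' hb'] <-] [<-]|//]; exists b'.
Qed.

Lemma quotient_basis_transfer (V V' : lmodType K) (U W : set V) (U' W' : set V')
    (f : {linear V -> V'}) n (b : 'I_n -> V) :
  (forall u, U u -> U' (f u)) -> (forall u', U' u' -> exists2 u, U u & f u = u') ->
  (forall v, W' (f v) <-> W v) ->
  quotient_basis U W b -> quotient_basis U' W' (fun i => f (b i)).
Proof.
move=> fU fUs fW [Ub hb]; split=> [i|_ /fUs[u Uu <-]]; first exact: fU.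
have [c [hc cu]] := hb _ Uu.
have fE (e : 'rV[K]_n) :
  f u - \sum_i e 0 i *: f (b i) = f (u - \sum_i e 0 i *: b i).
  rewrite (linearB f) (linear_sum f); congr (_ - _).
  by apply: eq_bigr => i _; rewrite linearZ.
exists c; split; first by rewrite /= fE; apply/fW.
by move=> e; rewrite fE => /fW /cu.
Qed.

Lemma kernel_basis_free (V : lmodType K) (U : set V) n (b : 'I_n -> V) :
  U 0 -> quotient_basis U [set 0] b ->
  forall c : 'I_n -> K, \sum_i c i *: b i = 0 -> forall i, c i = 0.
Proof.
move=> U0 [_ hb] c c0 i; have [e [_ eu]] := hb _ U0.
have e1 : e = 0.
  by apply: eu => /=; rewrite big1 ?subr0// => j _; rewrite mxE scale0r.
have e2 : e = \row_j c j.
  apply: eu => /=; under eq_bigr => j _ do rewrite mxE.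
  by rewrite c0 subrr.
by move: e1; rewrite e2 => /rowP/(_ i); rewrite !mxE.
Qed.

Lemma kernel_basis_span (V : lmodType K) (U : set V) n (b : 'I_n -> V) u :
  quotient_basis U [set 0] b -> U u ->
  exists c : 'I_n -> K, u = \sum_i c i *: b i.
Proof.
move=> [_ hb] /hb[c [/eqP hc _]]; exists (fun i => c 0 i).
by apply/eqP; rewrite -subr_eq0.
Qed.

(** The coordinates of b' in b form a square matrix with independent rows, hence
an invertible one. *)
Lemma subspace_same_dim (V : lmodType K) (U U' : set V) n
    (b b' : 'I_n -> V) :
  U' 0 -> (forall a x y, U' x -> U' y -> U' (a *: x + y)) ->
  quotient_basis U [set 0] b -> quotient_basis U' [set 0] b' ->
  (forall u, U' u -> U u) -> forall u, U u -> U' u.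
Proof.
move=> U'0 U'lin hb hb' sub u Uu.
have /choice[c hc] i : exists c : 'I_n -> K, b' i = \sum_j c j *: b j.
  exact: kernel_basis_span hb (sub _ (hb'.1 i)).
pose A := \matrix_(i < n, j < n) c i j.
have Afree : row_free A.
  apply/inj_row_free => v vA; apply/rowP => i; rewrite mxE.
  apply: (kernel_basis_free U'0 hb' (c := fun i => v 0 i)).
  under eq_bigr => k _ do rewrite hc scaler_sumr.
  rewrite exchange_big big1// => j _.
  transitivity ((v *m A) 0 j *: b j); last by rewrite vA mxE scale0r.
  by rewrite mxE scaler_suml; apply: eq_bigr => k _; rewrite scalerA mxE.
have Au : A \in unitmx by rewrite -row_free_unit.
have bE i : b i = \sum_k invmx A i k *: b' k.
  under eq_bigr => k _ do rewrite hc scaler_sumr.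
  rewrite exchange_big.
  transitivity (\sum_j (invmx A *m A) i j *: b j).
    rewrite mulVmx// (bigD1 i)//= mxE eqxx scale1r big1 ?addr0// => j ji.
    by rewrite mxE eq_sym (negbTE ji) scale0r.
  apply: eq_bigr => j _; rewrite mxE scaler_suml.
  by apply: eq_bigr => k _; rewrite scalerA mxE.
have U'sum (m : nat) (e : 'I_m -> K) (F : 'I_m -> V) :
    (forall i, U' (F i)) -> U' (\sum_i e i *: F i).
  move=> HF; elim/big_ind: _ => // [x y Ux Uy|i _].
    by rewrite -[x]scale1r; exact: U'lin.
  by rewrite -[_ *: _]addr0; exact: U'lin.
have [e ->] := kernel_basis_span hb Uu.
by apply: (U'sum) => i; rewrite bE; apply: (U'sum) => k; exact: hb'.1.
Qed.

End QuotientDimension.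

(** * Bordered inverses of Fredholm operators *)
Section BorderedInverse.
Variables (R : realType) (X Y : completeNormedModType R[i]).
Local Notation C := (R[i]).
Variables (T : {linear X -> Y}) (M : R).
Hypothesis bT : opbound T M.
Variables (n m : nat) (v : 'I_n -> X) (y : 'I_m -> Y) (f : 'I_n -> X -> C).
Hypothesis vT : quotient_basis (null_space T) [set 0] v.
Hypothesis yT : quotient_basis [set: Y] (range T) y.
Hypothesis fb : forall i, exists K, functional (f i) K.
Hypothesis fv : \matrix_(i, j) f i (v j) \in unitmx.

Let F := \matrix_(i, j) f i (v j).

Let T_kernel c : T (\sum_j c j *: v j) = 0.
Proof.
rewrite linear_sum big1// => j _; rewrite linearZ /=.
have -> : T (v j) = 0 by exact: (vT.1 j).
by rewrite scaler0.
Qed.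

Let f_combination i x c :
  f i (x + \sum_j c j *: v j) = f i x + \sum_j c j * f i (v j).
Proof.
by have [K fK] := fb i; rewrite (functionalD fK) (functional_sum fK).
Qed.

Lemma adjust_functionals x (d : 'cV[C]_n) :
  exists2 x', T x' = T x & forall i, f i x' = d i 0.
Proof.
pose e := invmx F *m (d - \col_i f i x).
exists (x + \sum_j e j 0 *: v j) => [|i]; first by rewrite linearD T_kernel addr0.
rewrite f_combination.
have -> : \sum_j e j 0 * f i (v j) = (F *m e) i 0.
  by rewrite !mxE; apply: eq_bigr => j _; rewrite !mxE mulrC.
by rewrite mulKVmx// !mxE addrCA subrr addr0.
Qed.

Lemma kernel_functionals_separate x : T x = 0 -> (forall i, f i x = 0) -> x = 0.
Proof.
move=> Tx fx; have [e xE] := kernel_basis_span vT Tx.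
suff e0 : \col_j e j = 0.
  rewrite xE big1// => j _; have := congr1 (fun a : 'cV_n => a j 0) e0.
  by rewrite !mxE => ->; rewrite scale0r.
rewrite -[\col_j e j](mulKmx fv); have -> : F *m (\col_j e j) = 0.
  apply/colP => i; rewrite !mxE -[RHS](fx i) xE.
  have [K fK] := fb i; rewrite (functional_sum fK).
  by apply: eq_bigr => j _; rewrite !mxE mulrC.
by rewrite mulmx0.
Qed.

(** This operator is bijective because f complements the kernel of T and y its
range; its inverse, which is bounded by the open mapping theorem, contains
everything that is needed about T. *)
Let bordered_fun (p : X * 'rV[C]_m) : Y * 'rV[C]_n :=
  (T p.1 + \sum_i p.2 0 i *: y i, \row_i f i p.1).

Let bordered_linear : linear bordered_fun.
Proof.
move=> a p q; rewrite /bordered_fun; congr (_, _).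
  rewrite linearP /= scalerDr addrACA; congr (_ + _).
  rewrite scaler_sumr -big_split; apply: eq_bigr => i _.
  by rewrite !mxE scalerDl scalerA.
apply/rowP => i; rewrite !mxE; have [K fK] := fb i.
exact: fK.1.
Qed.

Let bordered_inj p q : bordered_fun p = bordered_fun q -> p = q.
Proof.
case: p q => [x c] [x' c'] [/= e1 /rowP e2].
have [d [_ du]] := yT.2 (T x + \sum_i c 0 i *: y i) I.
have cc' : c = c'.
  rewrite -(du c) ?(du c')//; first by exists x'; rewrite // e1 addrK.
  by exists x; rewrite // addrK.
congr (_, _) => //; apply/eqP; rewrite -subr_eq0; apply/eqP.
apply: kernel_functionals_separate => [|i].
  by rewrite linearB; apply/eqP; rewrite subr_eq0; move: e1; rewrite cc' => /addIr ->.
have := e2 i; rewrite !mxE => e; have [K fK] := fb i.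
by rewrite (functionalB fK) e subrr.
Qed.

Lemma bordered_bounded : exists K, 0 <= K /\ forall z, exists (x : X) (c : 'rV[C]_m),
  [/\ T x + \sum_i c 0 i *: y i = z, forall i, f i x = 0, rnorm x <= K * rnorm z &
      forall i, cmod (c 0 i) <= K * rnorm z].
Proof.
have nX := @rnorm_is_norm _ X; have nY := @rnorm_is_norm _ Y.
have [D DE] := linear_fun_of bordered_linear.
have [k kf] := choice fb.
pose B := `|M| + \sum_i rnorm (y i) + \sum_i `|k i|.
have bD : opb (@ext_norm _ X m) (@ext_norm _ Y n) D B.
  move=> p; rewrite DE /bordered_fun /ext_norm /= !mulrDl; apply: lerD.
    apply: le_trans (norm_triangle nY _ _) _; apply: lerD.
      apply: le_trans (bT _) _.
      apply: (@le_trans _ _ (`|M| * rnorm p.1)).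
        by rewrite ler_wpM2r ?ler_norm ?(norm_nonneg nX).
      by rewrite ler_wpM2l// rnorm_le_ext.
    apply: le_trans (norm_sum_le nY _) _; rewrite mulr_suml ler_sum// => i _.
    by rewrite (norm_scale nY) mulrC ler_wpM2l ?(norm_nonneg nY)// coord_le_ext.
  rewrite mulr_suml ler_sum// => i _; rewrite mxE.
  apply: le_trans ((functional_bound_abs (kf i)).2 _) _.
  by rewrite ler_wpM2l// rnorm_le_ext.
have sD q : exists p, D p = q.
  case: q => z d; have [c [[x0 _ x0E] _]] := yT.2 z I.
  have [x Tx fx] := adjust_functionals x0 d^T.
  exists (x, c); rewrite DE /bordered_fun /= Tx x0E subrK; congr (_, _).
  by apply/rowP => i; rewrite mxE fx mxE.
have [K [K0 hK]] := open_mapping (@ext_is_norm _ X m) (@ext_is_norm _ Y n)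
  (@ext_complete _ X m) (@ext_complete _ Y n) bD sD.
exists K; split=> // z; have [[x c] [Dxc xc]] := hK (z, 0).
have zE : ext_norm (z, 0 : 'rV[C]_n) = rnorm z.
  by rewrite /ext_norm /= big1 ?addr0// => i _; rewrite mxE cmod0.
rewrite zE in xc; exists x, c; move: Dxc; rewrite DE => -[e1 /rowP e2].
split=> [//|i||i]; first by have := e2 i; rewrite !mxE.
  exact: le_trans (rnorm_le_ext (x, c)) xc.
exact: le_trans (coord_le_ext (x, c) i) xc.
Qed.

(** The five properties determine L from T, f and y alone, so that inverses of
different operators with the same f and y can be compared. *)
Theorem bordered_inverse : exists L : {linear Y -> X},
  [/\ exists B, opbound L B,
      forall x, (forall i, f i x = 0) -> L (T x) = x,
      forall i, L (y i) = 0,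
      forall z, exists c : 'I_m -> C, T (L z) = z - \sum_i c i *: y i
    & forall z i, f i (L z) = 0].
Proof.
have [K [K0 /choice[g hg]]] := bordered_bounded.
have gE x (c : 'rV[C]_m) : (forall i, f i x = 0) -> g (T x + \sum_i c 0 i *: y i) = x.
  move=> fx; have [c' [e fg _ _]] := hg (T x + \sum_i c 0 i *: y i).
  suff [] : (g (T x + \sum_i c 0 i *: y i), c') = (x, c) by [].
  apply: bordered_inj; rewrite /bordered_fun /= e; congr (_, _).
  by apply/rowP => i; rewrite !mxE fg fx.
have lg : linear g.
  move=> a z z'; have [c [e fg _ _]] := hg z; have [c' [e' fg' _ _]] := hg z'.
  rewrite -{1}e -{1}e'.
  have -> : a *: (T (g z) + \sum_i c 0 i *: y i) +
      (T (g z') + \sum_i c' 0 i *: y i) =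
      T (a *: g z + g z') + \sum_i (a *: c + c') 0 i *: y i.
    by have := bordered_linear a (g z, c) (g z', c') => -[].
  by apply: gE => i; have [k kf] := fb i; rewrite kf.1 fg fg' mulr0 addr0.
have [L LE] := linear_fun_of lg; exists L.
split=> [|x fx|i|z|z i].
- by exists K => z; rewrite LE; have [c []] := hg z.
- rewrite LE -[RHS](gE x 0)//; congr g.
  by rewrite big1 ?addr0// => i _; rewrite mxE scale0r.
- rewrite LE -[RHS](gE 0 (delta_mx 0 i)).
    congr g; rewrite linear0 add0r (bigD1 i)//= mxE !eqxx scale1r big1 ?addr0//.
    by move=> j ji; rewrite mxE (negbTE ji) andbF scale0r.
  by move=> j; have [k kf] := fb j; rewrite (functional0 kf).
- have [c [e _ _ _]] := hg z; exists (fun i => c 0 i).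
  by rewrite LE -[X in X - _]e addrK.
- by rewrite LE; have [c []] := hg z.
Qed.

Lemma inner_inverse_of_left (L : {linear Y -> X}) :
  (forall x, (forall i, f i x = 0) -> L (T x) = x) ->
  forall x, T (L (T x)) = T x.
Proof.
move=> hL x; have [x' <- fx'] := adjust_functionals x 0.
by rewrite hL// => i; rewrite fx' mxE.
Qed.

Lemma quotient_coordinates_bounded : exists K, forall z (c : 'rV[C]_m),
  range T (z - \sum_i c 0 i *: y i) -> forall i, cmod (c 0 i) <= K * rnorm z.
Proof.
have [K [K0 hK]] := bordered_bounded; exists K => z c zc i.
have [x [c' [zE _ _ cK]]] := hK z.
have [d [_ du]] := yT.2 z I.
have dc : d = c by exact: du.
have dc' : d = c' by apply: du; exists x; rewrite // -zE addrK.
by rewrite -dc dc'.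
Qed.

End BorderedInverse.

(** * Generalized inverses along a pencil *)
Section PencilLinear.
Variables (K : fieldType) (V W : lmodType K) (T S : {linear V -> W}) (l : K).

Lemma pencil_is_linear : linear (pencil T S l).
Proof.
move=> a x y; rewrite /pencil (linearP T) (linearP S) !scalerDr scalerN opprD addrACA !scalerA.
by rewrite [l * a]mulrC.
Qed.

HB.instance Definition _ := GRing.isLinear.Build K V W *:%R (pencil T S l)
  pencil_is_linear.

Lemma pencilE x : pencil T S l x = T x - l *: S x. Proof. by []. Qed.

End PencilLinear.

Lemma range_linear (K : fieldType) (V W : lmodType K) (T : {linear V -> W}) a x y :
  range T x -> range T y -> range T (a *: x + y).
Proof. by move=> [u _ <-] [w _ <-]; exists (a *: u + w); rewrite ?linearP. Qed.

Lemma zero_linear (K : fieldType) (V : lmodType K) a (x y : V) :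
  [set 0] x -> [set 0] y -> [set (0 : V)] (a *: x + y).
Proof. by move=> /= -> ->; rewrite scaler0 addr0. Qed.

(** Q inverts I - l A rather than l I - A, so that l = 0 is allowed. *)
Definition is_resolvent (K : fieldType) (V : lmodType K) (A : V -> V) (l : K)
    (Q : V -> V) :=
  (forall y, Q (y - l *: A y) = y) /\ (forall y, Q y - l *: A (Q y) = y).

Section Pencil.
Variables (K : fieldType) (X Y : lmodType K).
Variables (T S : {linear X -> Y}) (L : {linear Y -> X}).
Hypothesis TLT : forall x, T (L (T x)) = T x.
Variables (l : K) (Q : {linear Y -> Y}).
Hypothesis hQ : is_resolvent (S \o L) l Q.

Let Q1 y : Q (y - l *: S (L y)) = y. Proof. exact: hQ.1. Qed.
Let Q2 y : Q y - l *: S (L (Q y)) = y. Proof. exact: hQ.2. Qed.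
Local Notation Tl := (pencil T S l).

(** The inverse of I - l L S, obtained from the inverse Q of I - l S L. *)
Definition kernel_transport x := x + l *: L (Q (S x)).
Local Notation Psi := kernel_transport.

Lemma kernel_transport_linear : linear Psi.
Proof.
move=> a x y; rewrite /Psi (linearP S) (linearP Q) (linearP L) !scalerDr !scalerA addrACA.
by rewrite [l * a]mulrC.
Qed.

Lemma kernel_transportK x : Psi (x - l *: L (S x)) = x.
Proof.
rewrite /Psi linearB [X in Q (_ - X)](_ : _ = l *: S (L (S x))).
  by rewrite Q1 subrK.
by rewrite linearZ.
Qed.

Lemma kernel_transport_inv x : Psi x - l *: L (S (Psi x)) = x.
Proof.
have e : S (Psi x) = Q (S x).
  by rewrite /Psi linearD linearZ /= -{1}[S x]Q2 subrK.
by rewrite e /Psi addrK.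
Qed.

Lemma pencil_kernel_sub x : Tl x = 0 -> Psi (x - L (T x)) = x.
Proof.
move=> /eqP; rewrite pencilE subr_eq0 => /eqP ->.
by rewrite linearZ /= kernel_transportK.
Qed.

(** The defect which has to vanish for l to be regular. *)
Lemma pencil_kernel_transport u : T u = 0 ->
  Tl (Psi u) = - l *: (Q (S u) - T (L (Q (S u)))).
Proof.
move=> Tu; set z := Q (S u).
have Su : S u = z - l *: S (L z) by rewrite Q2.
have SP : S (Psi u) = z.
  by rewrite /Psi linearD linearZ /= -/z Su subrK.
rewrite pencilE SP /Psi linearD Tu add0r linearZ /= -/z.
by rewrite scalerBr !scaleNr opprK addrC.
Qed.

Lemma pencil_left_factor x : Tl (L (T x)) = T x - l *: S (L (T x)).
Proof. by rewrite pencilE TLT. Qed.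

Section Regular.
Hypothesis hreg : forall u, T u = 0 -> Tl (Psi u) = 0.

(** With x = L T x + u and T u = 0, the first part is sent by T_l to
(I - l A) T x, while T_l u = - l S u, where Q (l S u) is in the range of T by
regularity. *)
Lemma pencil_range_resolvent x : exists z, Q (Tl x) = T z.
Proof.
pose u := x - L (T x).
have Tu : T u = 0 by rewrite linearB TLT subrr.
have := hreg Tu; rewrite pencil_kernel_transport// => h.
exists (L (T x) + (- l) *: L (Q (S u))) => //.
have -> : Tl x = (T x - l *: S (L (T x))) + - l *: S u.
  rewrite pencilE /u (linearB S) scalerBr !scaleNr opprK addrACA.
  by rewrite addNr addr0.
rewrite (linearD Q) Q1 (linearD T) TLT !linearZ /=; congr (_ + _).
by apply/eqP; rewrite -subr_eq0 -scalerBr h.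
Qed.

Lemma pencil_inner_inverse x : Tl (L (Q (Tl x))) = Tl x.
Proof.
by have [z zE] := pencil_range_resolvent x; rewrite zE pencil_left_factor -zE Q2.
Qed.

Lemma pencil_kernel_basis n (v : 'I_n -> X) :
  quotient_basis (null_space T) [set 0] v ->
  quotient_basis (null_space Tl) [set 0] (fun i => Psi (v i)).
Proof.
have [P PE] := linear_fun_of kernel_transport_linear => hv.
have -> : (fun i => Psi (v i)) = (fun i => P (v i)) by apply/funext => i; rewrite PE.
apply: quotient_basis_transfer hv => [u Tu|x Tlx|x].
- by rewrite PE; exact: hreg.
- exists (x - L (T x)); first by rewrite /null_space /= linearB TLT subrr.
  by rewrite PE; exact: pencil_kernel_sub.
- split=> [/= Px|-> /=]; last by rewrite linear0.
  by rewrite -(kernel_transport_inv x) -PE Px !linear0 addr0.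
Qed.

Lemma pencil_range_basis m (y : 'I_m -> Y) :
  quotient_basis [set: Y] (range T) y ->
  exists y' : 'I_m -> Y, quotient_basis [set: Y] (range Tl) y'.
Proof.
have lI : linear (fun z => z - l *: S (L z)).
  move=> a z w; rewrite (linearP L) (linearP S) !scalerDr scalerN opprD addrACA !scalerA.
  by rewrite [l * a]mulrC.
have [I IE] := linear_fun_of lI => hy.
exists (fun i => I (y i)); apply: quotient_basis_transfer hy => // [z _|z].
  by exists (Q z); rewrite // IE Q2.
rewrite IE; split=> [[x _ e]|[x _ <-]].
  have [w wE] := pencil_range_resolvent x.
  by exists w; rewrite // -wE e Q1.
by exists (L (T x)); rewrite // pencil_left_factor.
Qed.

End Regular.

(** Psi (ker T) always contains ker T_l; when the finite dimensions agree, the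
two are equal. *)
Lemma pencil_regular_of_dim n (v v' : 'I_n -> X) :
  quotient_basis (null_space T) [set 0] v ->
  quotient_basis (null_space Tl) [set 0] v' ->
  forall u, T u = 0 -> Tl (Psi u) = 0.
Proof.
move=> hv hv' u Tu.
have [P PE] := linear_fun_of kernel_transport_linear.
have hP : quotient_basis [set P x | x in null_space T] [set 0] (fun i => P (v i)).
  apply: quotient_basis_transfer hv => [x Tx|_ [x Tx <-]|x]; [by exists x|by exists x|].
  split=> [/= Px|-> /=]; last by rewrite linear0.
  by rewrite -(kernel_transport_inv x) -PE Px !linear0 addr0.
rewrite -PE; apply: (subspace_same_dim _ _ hP hv').
- exact: linear0.
- move=> a x y; rewrite /null_space /= linearP /= => -> ->.
  by rewrite scaler0 addr0.
- move=> x Tlx; exists (x - L (T x)); first by rewrite /null_space /= linearB TLT subrr.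
  by rewrite PE; exact: pencil_kernel_sub.
- by exists u.
Qed.

End Pencil.

(** * Resolvents, compactness and continuation *)
Section OperatorBounds.
Variable R : realType.
Implicit Types X Y Z : normedModType R[i].

Lemma opb_absr X Y (f : X -> Y) M :
  opbound f M -> opbound f `|M|.
Proof.
move=> fM x; apply: le_trans (fM x) _.
by rewrite ler_wpM2r ?ler_norm// (norm_nonneg (@rnorm_is_norm _ _)).
Qed.

Lemma opb_le X Y (f : X -> Y) M M' : M <= M' ->
  opbound f M -> opbound f M'.
Proof.
move=> MM' fM x; apply: le_trans (fM x) _.
by rewrite ler_wpM2r// (norm_nonneg (@rnorm_is_norm _ _)).
Qed.

Lemma opb_comp X Y Z (f : X -> Y) (g : Y -> Z) M N : 0 <= N ->
  opbound f M -> opbound g N ->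
  opbound (g \o f) (N * M).
Proof.
move=> N0 fM gN x; apply: le_trans (gN _) _.
by rewrite -mulrA ler_wpM2l.
Qed.

Lemma opb_iter X (f : X -> X) M n : 0 <= M ->
  opbound f M -> opbound (iter n f) (M ^+ n).
Proof.
move=> M0 fM; elim: n => [|n IH] x /=; first by rewrite expr0 mul1r.
apply: le_trans (fM _) _; rewrite exprS -mulrA ler_wpM2l//; exact: IH.
Qed.

End OperatorBounds.

Lemma resolvent_zero (K : fieldType) (V : lmodType K) (A Q : V -> V) :
  is_resolvent A 0 Q -> forall y, Q y = y.
Proof. by move=> [h _] y; have := h y; rewrite scale0r subr0. Qed.

Section Resolvents.
Variables (R : realType) (Y : completeNormedModType R[i]).
Local Notation C := (R[i]).
Local Notation N := (@rnorm _ Y).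
Variables (A : {linear Y -> Y}) (a : R).
Hypothesis bA : opbound A a.

(** I - l A = (I - l0 A) (I - B) with B = (l - l0) Q0 A. *)
Lemma resolvent_near (l0 l : C) (Q0 : {linear Y -> Y}) c :
  is_resolvent A l0 Q0 -> opbound Q0 c -> 0 <= c ->
  cmod (l - l0) * (c * a) <= 1 / 2 ->
  exists Q : {linear Y -> Y}, is_resolvent A l Q /\ opbound Q (2 * c).
Proof.
move=> [Q01 Q02] bQ c0 small.
have nY := @rnorm_is_norm _ Y.
have lB : linear (fun y => (l - l0) *: Q0 (A y)).
  move=> b x y; rewrite (linearP A) (linearP Q0) scalerDr !scalerA.
  by rewrite [_ * b]mulrC.
have [B BE] := linear_fun_of lB.
have bB : opbound B (1 / 2).
  move=> y; rewrite BE (norm_scale nY).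
  apply: (@le_trans _ _ (cmod (l - l0) * (c * a) * N y)).
    rewrite -mulrA ler_wpM2l ?cmod_ge0//; exact: (opb_comp c0 bA bQ).
  by rewrite ler_wpM2r ?(norm_nonneg nY).
have [G [G1 G2 bG]] := neumann bB.
exists [the {linear Y -> Y} of G \o Q0]; split; last first.
  by apply: opb_comp.
have AE y : l *: A y = l0 *: A y + (l - l0) *: A y.
  by rewrite -scalerDl addrCA subrr addr0.
split=> y /=.
  rewrite AE opprD addrA linearB Q01 linearZ /= -BE; exact: G1.
set x := G (Q0 y); have xE : x - B x = Q0 y by exact: G2.
have A2 : B x - l0 *: A (B x) = (l - l0) *: A x.
  have AZ b u : A (b *: u) = b *: A u by rewrite linearZ.
  by rewrite BE -[in RHS](Q02 (A x)) scalerBr AZ !scalerA [l0 * _]mulrC.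
rewrite AE opprD addrA -A2 opprD opprK addrACA xE -[in RHS](Q02 y) -xE.
by rewrite linearB scalerBr opprB [- _ + _]addrC.
Qed.

End Resolvents.

Section CompactDisc.
Variable R : realType.
Local Notation C := (R[i]).

(** Otherwise there are points u n at which P fails with the bound n; near a
cluster point of u in the disc this is contradictory. *)
Lemma disc_uniform_bound (P : C -> R -> Prop) (rho : R) :
  (forall l c c', c <= c' -> P l c -> P l c') ->
  (forall l0, cmod l0 <= rho -> exists c e, 0 < e /\
     forall l, cmod (l - l0) < e -> cmod l <= rho -> P l c) ->
  exists c, forall l, cmod l <= rho -> P l c.
Proof.
move=> Pmono Ploc; apply: contrapT => H.
have /choice[u uP] (n : nat) : exists l, cmod l <= rho /\ ~ P l n%:R.
  apply: contrapT => Hn; apply: H; exists n%:R => l lr.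
  by apply: contrapT => Pl; apply: Hn; exists l.
pose v n : R * R := (complex.Re (u n), complex.Im (u n)).
have cK : compact (`[- rho, rho] `*` `[- rho, rho] : set (R * R)).
  by apply: compact_setX; exact: segment_compact.
have [|p [_ pcl]] := cK (v @ \oo) _.
  exists 0%N => // n _ /=; rewrite !in_itv /= -!ler_norml.
  have [ul _] := uP n.
  by split; apply: le_trans ul; [exact: Re_le_cmod | exact: Im_le_cmod].
pose l0 : C := p.1 +i* p.2.
have near N e : 0 < e -> exists2 n, (N <= n)%N & cmod (u n - l0) < e.
  move=> e0; have [||q [[n Nn <-] [h1 h2]]] :=
    pcl [set v n | n in [set n | (N <= n)%N]] (ball p (e / 2)).
  - by exists N => // n Nn; exists n.
  - by apply: nbhsx_ballx; rewrite divr_gt0.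
  exists n => //; apply: le_lt_trans (cmod_le_ReIm _) _.
  move: h1 h2; rewrite /ball /= !raddfB /= => h1 h2.
  rewrite distrC [`|_ - p.2|]distrC; lra.
have l0r : cmod l0 <= rho.
  apply/ler_addgt0Pl => e /(near 0%N)[n _ hn].
  have := cmodD (u n) (l0 - u n); rewrite addrCA subrr addr0 cmodC.
  by have := (uP n).1; move: hn; lra.
have [c [e [e0 hc]]] := Ploc _ l0r.
have [n nc hn] := near (Num.bound `|c|) e e0.
have [ur nP] := uP n; apply: nP; apply: Pmono (hc _ hn ur).
apply: le_trans (ler_norm _) _; apply: ltW.
by apply: lt_le_trans (archi_boundP _) _; rewrite ?ler_nat.
Qed.

Lemma ray_induction (P : C -> Prop) (rho h : R) : 0 < h -> P 0 ->
  (forall l l', cmod l <= rho -> cmod l' <= rho -> cmod (l' - l) <= h ->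
     P l -> P l') ->
  forall l, cmod l <= rho -> P l.
Proof.
move=> h0 P0 step l lr.
have r0 : 0 <= rho by apply: le_trans lr; exact: cmod_ge0.
pose n := (Num.bound (rho / h)).+1.
have hn : rho <= n%:R * h.
  rewrite -ler_pdivrMr// ltW// (lt_le_trans (archi_boundP _))//.
    by rewrite divr_ge0// ltW.
  by rewrite ler_nat.
have n0 : 0 < n%:R :> R by rewrite ltr0n.
pose t (k : nat) : C := (k%:R / n%:R)%:C * l.
have tr k : (k <= n)%N -> cmod (t k) <= rho.
  move=> kn; rewrite cmodM cmod_real ger0_norm ?divr_ge0//.
  apply: le_trans lr; rewrite ler_piMl ?cmod_ge0// ler_pdivrMr// mul1r.
  by rewrite ler_nat.
suff Pt k : (k <= n)%N -> P (t k).
  by have := Pt n (leqnn n); rewrite /t divff ?mul1r// gt_eqF.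
elim: k => [|k IH] kn; first by rewrite /t !mul0r.
apply: step (IH (ltnW kn)); [exact/tr/ltnW | exact: tr |].
rewrite -mulrBl -rmorphB -mulrBl -natr1 addrAC subrr add0r.
rewrite cmodM cmod_real ger0_norm; last by rewrite divr_ge0.
rewrite mulrC mulrA mulr1 ler_pdivrMr// mulrC.
by apply: le_trans lr _.
Qed.

End CompactDisc.

(** In this section D is to be thought of as I - T L: a bounded operator whose
kernel is the subspace in which resolvent values are to be kept. *)
Section Continuation.
Variables (R : realType) (Y : completeNormedModType R[i]).
Local Notation C := (R[i]).
Local Notation N := (@rnorm _ Y).
Variables (A D : {linear Y -> Y}) (a d : R).
Hypotheses (a0 : 0 <= a) (bA : opbound A a) (d0 : 0 <= d) (bD : opbound D d).

(** The largest A-invariant subspace of the kernel of D. *)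
Let M z := forall n, D (iter n A z) = 0.

(** The hypothesis on z gives D z = 0 in the limit l -> 0, and it passes from z
to A z, because l Q A z = Q z - z. *)
Lemma germ_vanishes (e : R) z : 0 < e ->
  (forall l, l != 0 -> cmod l < e -> exists Q : {linear Y -> Y},
     [/\ is_resolvent A l Q, opbound Q 2 & D (Q z) = 0]) -> M z.
Proof.
move=> e0 + n; have nY := @rnorm_is_norm _ Y.
suff H w : (forall l, l != 0 -> cmod l < e -> exists Q : {linear Y -> Y},
     [/\ is_resolvent A l Q, opbound Q 2 & D (Q w) = 0]) ->
   D w = 0 /\ (forall l, l != 0 -> cmod l < e -> exists Q : {linear Y -> Y},
     [/\ is_resolvent A l Q, opbound Q 2 & D (Q (A w)) = 0]).
  elim: n z => [|n IH] z hz; first by have [] := H z hz.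
  by rewrite iterSr; apply: IH; have [] := H z hz.
move=> hw; have Dw : D w = 0.
  apply: (norm_small_eq0 nY) => s s0.
  pose k := d * (a * (2 * N w)) + 1.
  (* |D w| <= r d a 2 |w| for every small r; the 1 in k avoids a division by 0. *)
  have k0 : 0 < k by rewrite ltr_wpDl// !mulr_ge0// (norm_nonneg nY).
  pose r := Num.min (e / 2) (s / k).
  have r0 : 0 < r by rewrite lt_min !divr_gt0.
  have [||Q [[_ Q2] bQ DQ]] := hw r%:C.
  - by apply/eqP => /complexI h; rewrite h ltxx in r0.
  - rewrite cmod_real gtr0_norm// (@le_lt_trans _ _ (e / 2))//; last by lra.
    by rewrite ge_min lexx.
  rewrite -(Q2 w) linearB DQ sub0r linearZ /= (norm_opp nY) (norm_scale nY).
  rewrite cmod_real gtr0_norm//.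
  have h1 : N (D (A (Q w))) <= d * (a * (2 * N w)).
    apply: le_trans (bD _) _; rewrite ler_wpM2l//.
    by apply: le_trans (bA _) _; rewrite ler_wpM2l.
  apply: (@le_trans _ _ (s / k * k)); last by rewrite divfK ?gt_eqF.
  apply: ler_pM; rewrite ?(norm_nonneg nY) ?(ltW r0)//; first by rewrite ge_min lexx orbT.
  by apply: le_trans h1 _; rewrite lerDl.
split=> // l l0 le; have [Q [[Q1 Q2] bQ DQ]] := hw l l0 le.
exists Q; split=> //; have e1 : l *: Q (A w) = Q w - w.
  by rewrite -{3}(Q1 w) linearB linearZ opprB addrCA subrr addr0.
have : l *: D (Q (A w)) = 0 by rewrite -linearZ /= e1 linearB DQ Dw subrr.
by move/eqP; rewrite scaler_eq0 (negbTE l0) => /eqP.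
Qed.

(** It is enough to carry the invariance of M from l to a close l'.  There
w = Q' z satisfies w = Q z + B w, where B = (l' - l) Q A is a contraction which
preserves M, so w differs from B^k w by an element of M, and B^k w is small. *)
Lemma analytic_continuation (rho c : R) : 0 < c ->
  (forall l, cmod l <= rho -> exists Q : {linear Y -> Y},
     is_resolvent A l Q /\ opbound Q c) ->
  forall z, M z -> forall l (Q : {linear Y -> Y}), cmod l <= rho ->
    is_resolvent A l Q -> D (Q z) = 0.
Proof.
move=> c0 res z Mz l Q lr hQ; have nY := @rnorm_is_norm _ Y.
suff P : forall z, M z -> M (Q z) by exact: (P z Mz 0%N).
have MD x y : M x -> M y -> M (x + y).
  move=> Mx My n; have -> : iter n A (x + y) = iter n A x + iter n A y.
    by elim: n => //= n ->; rewrite linearD.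
  by rewrite linearD Mx My addr0.
have MZ b x : M x -> M (b *: x).
  move=> Mx n; have -> : iter n A (b *: x) = b *: iter n A x.
    by elim: n => //= n ->; rewrite linearZ.
  by rewrite linearZ /= Mx scaler0.
have MA x : M x -> M (A x) by move=> Mx n; rewrite -iterSr.
move: l lr Q hQ {z Mz}.
apply: (@ray_induction _ (fun l => forall Q : {linear Y -> Y},
  is_resolvent A l Q -> forall z, M z -> M (Q z)) rho (2 * (c * (a + 1)))^-1).
- by rewrite invr_gt0 !mulr_gt0// ltr_wpDl.
- by move=> Q hQ z Mz; rewrite (resolvent_zero hQ).
move=> l l' lr l'r ll' IH Q' [_ Q'2] z Mz.
have [Q [hQ bQ]] := res l lr; have {}IH := IH Q hQ.
pose B y := (l' - l) *: Q (A y); pose w := Q' z.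
have MB x : M x -> M (B x) by move=> Mx; apply: MZ; apply: IH; apply: MA.
have bB : opbound B (1 / 2).
  move=> y; rewrite /B (norm_scale nY).
  apply: (@le_trans _ _ ((2 * (c * (a + 1)))^-1 * (c * (a + 1) * N y))).
    apply: ler_pM; rewrite ?cmod_ge0 ?(norm_nonneg nY)//.
    apply: le_trans (bQ _) _; rewrite -mulrA ler_wpM2l ?(ltW c0)//.
    by apply: le_trans (bA _) _; rewrite ler_wpM2r ?(norm_nonneg nY)// lerDl.
  have k0 : c * (a + 1) != 0 by rewrite gt_eqF// mulr_gt0// ltr_wpDl.
  by rewrite invfM mulrA divfK// div1r.
have BD x y : B (x + y) = B x + B y by rewrite /B !linearD.
have wE : w = Q z + B w.
  have e : w - l *: A w = z + (l' - l) *: A w.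
    by rewrite -[z](Q'2 z) -/w scalerBl addrA subrK.
  by rewrite -{1}(hQ.1 w) e linearD linearZ.
have Mw k : M (w - iter k B w).
  elim: k => [|k IHk].
    by rewrite subrr -(scale0r z); exact: MZ.
  have -> : w - iter k.+1 B w = Q z + B (w - iter k B w).
    have BN : B (- iter k B w) = - B (iter k B w) by rewrite /B !linearN.
    by rewrite BD BN addrA -wE.
  by apply: MD; [exact: IH | exact: MB].
move=> n; apply: (norm_small_eq0 nY) => e e0.
have [k hk] := half_pow_small (d * (a ^+ n * N w)) e0.
have iterD m x y : iter m A (x + y) = iter m A x + iter m A y.
  by elim: m => //= m ->; rewrite linearD.
have -> : D (iter n A w) = D (iter n A (iter k B w)).
  by rewrite -[w in LHS](subrK (iter k B w)) iterD linearD Mw add0r.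
apply: le_trans hk; apply: le_trans (bD _) _; rewrite -!mulrA ler_wpM2l//.
apply: le_trans (opb_iter n a0 bA _) _; rewrite -?mulrA ler_wpM2l ?exprn_ge0//.
have h2 : 0 <= 1 / 2 :> R by rewrite divr_ge0.
by apply: le_trans (opb_iter k h2 bB _) _; rewrite div1r exprVn mulrC.
Qed.

End Continuation.

(** * Inner inverses on discs *)
Section PencilFamily.
Variables (K : fieldType) (V W : lmodType K) (T S : {linear V -> W}).

Lemma pencil0 : pencil T S 0 = T :> (V -> W).
Proof. by apply/funext => x; rewrite /pencil scale0r subr0. Qed.

Lemma pencil_pencil l0 l : pencil (pencil T S l0) S l = pencil T S (l0 + l) :> (V -> W).
Proof. by apply/funext => x; rewrite /pencil scalerDl opprD addrA. Qed.

End PencilFamily.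

Lemma kernel_dimE (K : fieldType) (V W : lmodType K) (T : V -> W) n (v : 'I_n -> V) :
  quotient_basis (null_space T) [set 0] v -> space_dim (null_space T) = Some n.
Proof. by apply: quotient_dimE => a x y; exact: zero_linear. Qed.

Lemma range_codimE (K : fieldType) (V W : lmodType K) (T : {linear V -> W}) m
    (y : 'I_m -> W) :
  quotient_basis [set: W] (range T) y -> space_codim (range T) = Some m.
Proof. by apply: quotient_dimE => a x x'; exact: range_linear. Qed.

Section InverseOnDiscs.
Variables (R : realType) (X Y : completeNormedModType R[i]).
Local Notation C := (R[i]).
Variables (T S : {linear X -> Y}) (t s : R).
Hypotheses (t0 : 0 <= t) (bT : opbound T t).
Hypotheses (s0 : 0 <= s) (bS : opbound S s).

Lemma resolvent_near_zero (Z : completeNormedModType R[i]) (A : {linear Z -> Z}) a l :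
  0 <= a -> opbound A a -> cmod l * a <= 1 / 2 ->
  exists Q : {linear Z -> Z}, is_resolvent A l Q /\ opbound Q 2.
Proof.
move=> a0 bA la.
have [||||Q [hQ bQ]] := @resolvent_near _ _ A a bA 0 l [the {linear Z -> Z} of idfun] 1.
- by split=> y /=; rewrite scale0r subr0.
- by move=> y /=; rewrite mul1r.
- exact: ler01.
- by rewrite subr0 mul1r.
by exists Q; split=> //; rewrite mulr1 in bQ.
Qed.

Section InnerInverse.
Variables (L : {linear Y -> X}) (b : R).
Hypotheses (b0 : 0 <= b) (bL : opbound L b).
Hypothesis TLT : forall x, T (L (T x)) = T x.
Local Notation A := ([the {linear Y -> Y} of S \o L]).

Let bA : opbound A (s * b).
Proof. exact: opb_comp. Qed.

Lemma resolvent_uniform (rho : R) :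
  (forall l, cmod l <= rho -> exists2 Q : {linear Y -> Y},
     is_resolvent A l Q & exists c, opbound Q c) ->
  exists2 c, 0 < c & forall l, cmod l <= rho -> exists Q : {linear Y -> Y},
     is_resolvent A l Q /\ opbound Q c.
Proof.
move=> hres; have sb0 : 0 <= s * b by rewrite mulr_ge0.
have [||c hc] := @disc_uniform_bound R (fun l c => exists Q : {linear Y -> Y},
    is_resolvent A l Q /\ opbound Q c) rho.
- by move=> l c c' cc' [Q [hQ bQ]]; exists Q; split=> //; exact: opb_le bQ.
- move=> l0 l0r; have [Q hQ [c /opb_absr bQ]] := hres l0 l0r.
  pose k := `|c| * (s * b) + 1; have k0 : 0 < k by rewrite ltr_wpDl// mulr_ge0.
  exists (2 * `|c|), (1 / (2 * k)); split=> [|l ll0 _].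
    by rewrite divr_gt0// mulr_gt0.
  apply: (resolvent_near bA hQ bQ) => //.
  apply: (@le_trans _ _ (1 / (2 * k) * k)).
    by apply: ler_pM; rewrite ?cmod_ge0 ?mulr_ge0// ?(ltW ll0)// lerDl.
  by rewrite invfM mul1r mulfVK ?gt_eqF// div1r.
exists (`|c| + 1) => [|l lr]; first by rewrite ltr_wpDl.
have [Q [hQ bQ]] := hc l lr; exists Q; split=> //; apply: opb_le bQ.
by apply: le_trans (ler_norm _) _; rewrite lerDl.
Qed.

(** Regularity at the points close to 0, where nullities are equal, spreads to
all points where the resolvents exist. *)
Lemma regular_on_disc (r rho : R) n (v : 'I_n -> X) : 0 < r ->
  quotient_basis (null_space T) [set 0] v ->
  (forall l, cmod l < r -> exists v' : 'I_n -> X,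
     quotient_basis (null_space (pencil T S l)) [set 0] v') ->
  (forall l, cmod l <= rho -> exists2 Q : {linear Y -> Y},
     is_resolvent A l Q & exists c, opbound Q c) ->
  forall l (Q : {linear Y -> Y}), cmod l <= rho -> is_resolvent A l Q ->
  forall u, T u = 0 -> pencil T S l (kernel_transport S L l Q u) = 0.
Proof.
move=> r0 hv hv' /resolvent_uniform[c c0 hc] l Q lr hQ u Tu.
have lD : linear (fun y => y - T (L y)).
  by move=> a x y; rewrite (linearP L) (linearP T) scalerBr opprD addrACA.
have [D DE] := linear_fun_of lD.
have bD : opbound D (1 + t * b).
  move=> y; rewrite DE mulrDl mul1r; apply: le_trans (norm_sub (@rnorm_is_norm _ Y) _ _) _.
  by rewrite lerD2l; exact: (opb_comp t0 bL bT).
have sb0 : 0 <= s * b by rewrite mulr_ge0.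
have d0 : 0 <= 1 + t * b by rewrite addr_ge0// mulr_ge0.
rewrite (pencil_kernel_transport hQ Tu) -DE.
suff -> : D (Q (S u)) = 0 by rewrite scaler0.
apply: (analytic_continuation sb0 bA d0 bD c0 hc _ lr hQ).
pose k := s * b + 1; have k0 : 0 < k by rewrite ltr_wpDl.
apply: (@germ_vanishes _ _ A D _ _ sb0 bA d0 bD (Num.min r (1 / (2 * k)))).
  by rewrite lt_min r0 divr_gt0// mulr_gt0.
move=> l' l'0; rewrite lt_min => /andP[l'r l'k].
have [|Q' [hQ' bQ']] := resolvent_near_zero (l := l') sb0 bA.
  apply: (@le_trans _ _ (1 / (2 * k) * k)).
    by apply: ler_pM; rewrite ?cmod_ge0// ?(ltW l'k)// lerDl.
  by rewrite invfM mul1r mulfVK ?gt_eqF// div1r.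
exists Q'; split=> //.
have [v' hv'l] := hv' l' l'r.
have := pencil_regular_of_dim TLT hQ' hv hv'l Tu.
rewrite (pencil_kernel_transport hQ' Tu) => /eqP.
by rewrite scaler_eq0 oppr_eq0 (negbTE l'0) /= DE => /eqP.
Qed.

End InnerInverse.

Section UniformInnerInverse.
Variables (n m : nat) (r : R).
Hypothesis kerT : forall l, cmod l < r -> exists v : 'I_n -> X,
  quotient_basis (null_space (pencil T S l)) [set 0] v.
Hypothesis cokerT : forall l, cmod l < r -> exists y : 'I_m -> Y,
  quotient_basis [set: Y] (range (pencil T S l)) y.

Lemma pencil_bounded l :
  opbound (pencil T S l) (t + cmod l * s).
Proof.
move=> x; rewrite mulrDl; apply: le_trans (norm_sub (@rnorm_is_norm _ Y) _ _) _.
apply: lerD; first exact: bT.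
rewrite (norm_scale (@rnorm_is_norm _ Y)).
by rewrite -mulrA ler_wpM2l ?cmod_ge0//; exact: bS.
Qed.

Lemma fredholm_inner_inverse l : cmod l < r -> exists L : {linear Y -> X},
  (exists c, opbound L c) /\
  forall x, pencil T S l (L (pencil T S l x)) = pencil T S l x.
Proof.
move=> lr; have [v hv] := kerT lr; have [y hy] := cokerT lr.
have [|f [fb fv]] := dual_functionals (v := v).
  have U0 : null_space (pencil T S l) 0 by exact: linear0.
  exact: kernel_basis_free U0 hv.
have fu : \matrix_(i, j) f i (v j) \in unitmx.
  suff -> : \matrix_(i, j) f i (v j) = 1%:M by exact: unitmx1.
  by apply/matrixP => i j; rewrite !mxE fv.
have [L [bL LT _ _ _]] := bordered_inverse (pencil_bounded l) hv hy fb fu.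
exists L; split=> // x.
exact: (inner_inverse_of_left hv fb fu LT).
Qed.

(** An inner inverse L at l0 gives the inner inverses L Q at the nearby points,
with twice its bound; compactness of the disc does the rest. *)
Lemma uniform_inner_inverse (rho : R) : rho < r -> exists2 c, 0 < c &
  forall l, cmod l <= rho -> exists L : {linear Y -> X},
    opbound L c /\
    forall x, pencil T S l (L (pencil T S l x)) = pencil T S l x.
Proof.
move=> rhor.
have [||c hc] := @disc_uniform_bound R (fun l c => exists L : {linear Y -> X},
    opbound L c /\
    forall x, pencil T S l (L (pencil T S l x)) = pencil T S l x) rho.
- by move=> l c c' cc' [L [bL hL]]; exists L; split=> //; exact: opb_le bL.
- move=> l0 l0r; have l0r' := le_lt_trans l0r rhor.
  have [L [[c /opb_absr bL] hL]] := fredholm_inner_inverse l0r'.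
  have sc0 : 0 <= s * `|c| by rewrite mulr_ge0.
  have bA : opbound [the {linear Y -> Y} of S \o L] (s * `|c|).
    exact: opb_comp.
  pose k := s * `|c| + 1; have k0 : 0 < k by rewrite ltr_wpDl.
  exists (`|c| * 2), (1 / (2 * k)); split=> [|l ll0 lr].
    by rewrite divr_gt0// mulr_gt0.
  have [|Q [hQ bQ]] := resolvent_near_zero (l := l - l0) sc0 bA.
    apply: (@le_trans _ _ (1 / (2 * k) * k)).
      by apply: ler_pM; rewrite ?cmod_ge0// ?(ltW ll0)// lerDl.
    by rewrite invfM mul1r mulfVK ?gt_eqF// div1r.
  exists [the {linear Y -> X} of L \o Q]; split; first exact: opb_comp.
  have E : pencil (pencil T S l0) S (l - l0) = pencil T S l :> (X -> Y).
    by rewrite pencil_pencil addrCA subrr addr0.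
  have [v hv] := kerT l0r'; have [v' hv'] := kerT (le_lt_trans lr rhor).
  rewrite -E in hv'.
  have := pencil_inner_inverse hL hQ (pencil_regular_of_dim hL hQ hv hv').
  by rewrite E.
exists (`|c| + 1) => [|l lr]; first by rewrite ltr_wpDl.
have [L [bL hL]] := hc l lr; exists L; split=> //; apply: opb_le bL.
by apply: le_trans (ler_norm _) _; rewrite lerDl.
Qed.

End UniformInnerInverse.
End InverseOnDiscs.

(** * Steering a family away from a moving subspace *)
Section DiscNet.
Variable R : realType.
Local Notation C := (R[i]).

(** Rounding towards 0, which keeps the net inside the segment, and later inside
the disc. *)
Lemma segment_net (rho g : R) : 0 < g -> exists r : seq R,
  forall x, `|x| <= rho -> exists2 y, y \in r & `|y| <= `|x| /\ `|x - y| <= g.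
Proof.
move=> g0; pose n := (Num.truncn (rho / g)).+1.
pose r0 := [seq k%:R * g | k <- iota 0 n].
exists (r0 ++ [seq - y | y <- r0]) => x xr.
suff [y yr [yx xy]] : exists2 y, y \in r0 & `|y| <= `|x| /\ `| `|x| - y| <= g.
  have [x0|x0] := leP 0 x.
    exists y; first by rewrite mem_cat yr.
    by split=> //; rewrite -{1}(ger0_norm x0).
  exists (- y); first by rewrite mem_cat map_f ?orbT.
  rewrite normrN; split=> //; rewrite opprK -normrN opprD.
  by rewrite -(ltr0_norm x0).
pose k := Num.truncn (`|x| / g).
have xg0 : 0 <= `|x| / g by rewrite divr_ge0// ltW.
have /andP[k1 k2] := truncn_itv xg0.
exists (k%:R * g).
  apply/mapP; exists k => //; rewrite mem_iota /= add0n ltnS.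
  by apply: le_truncn; rewrite ler_pM2r// invr_gt0.
have kg : k%:R * g <= `|x| by rewrite -ler_pdivlMr.
split; first by rewrite ger0_norm// mulr_ge0// ltW.
rewrite ger0_norm ?subr_ge0// lerBlDr.
by move: k2; rewrite ltr_pdivrMr// -/k -natr1 mulrDl mul1r addrC => /ltW.
Qed.

Lemma disc_net (rho h : R) : 0 < h -> exists s : seq C,
  (forall p, p \in s -> cmod p <= rho) /\
  forall l, cmod l <= rho -> exists2 p, p \in s & cmod (l - p) <= h.
Proof.
move=> h0; have g0 : 0 < h / 2 by rewrite divr_gt0.
have [r hr] := segment_net rho g0.
exists [seq p <- [seq x +i* y | x <- r, y <- r] | cmod p <= rho]; split.
  by move=> p; rewrite mem_filter => /andP[].
move=> l lr.
have [x xr [x1 x2]] := hr (complex.Re l) (le_trans (Re_le_cmod _) lr).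
have [y yr [y1 y2]] := hr (complex.Im l) (le_trans (Im_le_cmod _) lr).
exists (x +i* y).
  rewrite mem_filter allpairs_f// andbT; apply: le_trans lr.
  case: l x1 x2 y1 y2 => a b /= x1 _ y1 _; rewrite /cmod /=.
  apply: ler_wsqrtr; apply: lerD.
    by rewrite -[x ^+ 2]real_normK ?num_real// -[a ^+ 2]real_normK ?num_real// ler_sqr ?nnegrE.
  by rewrite -[y ^+ 2]real_normK ?num_real// -[b ^+ 2]real_normK ?num_real// ler_sqr ?nnegrE.
apply: le_trans (cmod_le_ReIm _) _; rewrite !raddfB /=; lra.
Qed.

End DiscNet.

(** The moving subspace is ker (q l), of codimension at most n.  The relation
bnd x a stands for a norm bound on x; it may hold for no a at all, as for the
unbounded ones among all functions on a space.  The hypothesis divide is the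
division of an element of ker (q l1) by l - l1, with a loss of at most Cd in
the bound. *)
Section Steering.
Variables (R : realType) (V : lmodType R[i]).
Local Notation C := (R[i]).
Variable bnd : V -> R -> Prop.
Hypothesis bndD : forall x y a b, bnd x a -> bnd y b -> bnd (x + y) (a + b).
Hypothesis bndZ : forall c x a, bnd x a -> bnd (c *: x) (cmod c * a).
Hypothesis bnd_le : forall x a b, a <= b -> bnd x a -> bnd x b.
Variables (n : nat) (rho : R) (q : C -> V -> 'rV[C]_n).
Hypothesis qlin : forall l, cmod l <= rho -> linear (q l).
Hypothesis qbnd : forall l, cmod l <= rho -> exists k, forall x a, bnd x a ->
  forall i, cmod (q l x 0 i) <= k * a.
Variable Cd : R.
Hypothesis Cd0 : 0 < Cd.
Hypothesis divide : forall l1 x a, cmod l1 <= rho -> bnd x a -> q l1 x = 0 ->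
  exists y, bnd y (Cd * a) /\
    forall l, cmod l <= rho -> q l x = (l - l1) *: q l y.

Definition coord_mx l (F : 'I_n -> V) := \matrix_(i, j) q l (F i) 0 j.
(** F is a basis modulo the kernel of q l. *)
Definition good F l := \det (coord_mx l F) != 0.
Definition family_bound (F : 'I_n -> V) (a : 'I_n -> R) :=
  forall i, 0 < a i /\ bnd (F i) (a i).

Let q_sum l (d : 'I_n -> C) F : cmod l <= rho ->
  q l (\sum_i d i *: F i) = \sum_i d i *: q l (F i).
Proof.
move=> /qlin/linear_fun_of[f fE]; rewrite -fE linear_sum.
by apply: eq_bigr => i _; rewrite linearZ /= fE.
Qed.

(** A vanishing determinant gives a combination x of F with q l1 x = 0.  The
member exchanged for x / (l - l1) is the one with the largest contribution
|c_p| a_p to the bound of x: then the new bound is a multiple of a_p alone. *)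
Lemma remove_zero l1 F a : cmod l1 <= rho -> family_bound F a ->
  \det (coord_mx l1 F) = 0 ->
  exists F' a', [/\ family_bound F' a', \prod_i a' i = Cd * n%:R * \prod_i a i
    & forall l, cmod l <= rho ->
      \det (coord_mx l F) = (l - l1) * \det (coord_mx l F')].
Proof.
move=> l1r Fa /eqP/det0P[c c0 cM].
have [i0 ci0] : exists i0, c 0 i0 != 0.
  apply: contrapT => H; move/eqP: c0; apply; apply/rowP => i; rewrite mxE.
  by apply/eqP/negPn/negP => ci; apply: H; exists i.
have [p pmax] : exists p, forall i, cmod (c 0 i) * a i <= cmod (c 0 p) * a p.
  have [p _ pmax] := @arg_maxP _ _ _ i0 xpredT (fun i => cmod (c 0 i) * a i) isT.
  by exists p => i; exact: pmax.
have cp : c 0 p != 0.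
  apply/eqP => cp; have := pmax i0; rewrite cp cmod0 mul0r leNgt.
  by rewrite mulr_gt0 ?cmod_gt0//; have [] := Fa i0.
pose d i := c 0 i / c 0 p.
have dp : d p = 1 by rewrite /d divff.
have da i : cmod (d i) * a i <= a p.
  rewrite /d cmodM cmodV mulrAC ler_pdivrMr ?cmod_gt0// [a p * _]mulrC.
  exact: pmax.
pose x := \sum_i d i *: F i.
have n0 : (0 < n)%N by apply: leq_ltn_trans (ltn_ord p).
have ap : 0 < a p by have [] := Fa p.
have xb : bnd x (n%:R * a p).
  have : bnd x (\sum_i cmod (d i) * a i).
    apply: (big_ind2 bnd) => [|u b w e|i _]; [|exact: bndD|exact: bndZ (Fa i).2].
    by have := bndZ 0 (Fa p).2; rewrite scale0r cmod0 mul0r.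
  apply: bnd_le; apply: le_trans (ler_sum _ (fun i _ => da i)) _.
  by rewrite sumr_const card_ord mulr_natl.
have qx0 : q l1 x = 0.
  rewrite q_sum//; apply/rowP => j; rewrite summxE mxE.
  transitivity ((c 0 p)^-1 * (c *m coord_mx l1 F) 0 j); last by rewrite cM mxE mulr0.
  rewrite mxE mulr_sumr; apply: eq_bigr => i _.
  by rewrite !mxE mulrA [_^-1 * _]mulrC.
have [y [yb hy]] := divide l1r xb qx0.
pose F' i := if i == p then y else F i.
pose a' i := if i == p then Cd * (n%:R * a p) else a i.
exists F', a'; split.
- move=> i; rewrite /F' /a'; case: eqP => _ //; split=> //.
  by rewrite !mulr_gt0// ltr0n.
- rewrite (bigD1 p)//= [in RHS](bigD1 p)//= /a' eqxx !mulrA; congr (_ * _).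
  by apply: eq_bigr => i /negbTE ->.
move=> l lr; set M := coord_mx l F; set M' := coord_mx l F'.
(* Both determinants are expanded along row p, where they share cofactors. *)
have cof j : cofactor M' p j = cofactor M p j.
  rewrite /cofactor; congr (_ * \det _); apply/matrixP => i k; rewrite !mxE.
  by rewrite /F' -[_ == p]negbK eq_sym neq_lift.
rewrite (expand_det_row M' p) mulr_sumr.
transitivity (\sum_j q l x 0 j * cofactor M p j); last first.
  apply: eq_bigr => j _; rewrite cof [RHS]mulrA; congr (_ * _).
  by rewrite hy// [M' p j]mxE [in LHS]mxE /F' eqxx.
transitivity (\sum_i d i * (M *m \adj M) i p).
  rewrite mul_mx_adj (bigD1 p)//= dp [_%:M p p]mxE eqxx mul1r mulr1n big1 ?addr0// => i ip.
  by rewrite [_%:M i p]mxE (negbTE ip) mulr0n mulr0.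
under [RHS]eq_bigr => j _ do rewrite q_sum// summxE mulr_suml.
rewrite [RHS]exchange_big; apply: eq_bigr => i _; rewrite mxE mulr_sumr.
by apply: eq_bigr => j _; rewrite mxE /M !mxE mulrA.
Qed.

(** A crude form of the Hadamard inequality. *)
Lemma coord_det_bound l : cmod l <= rho -> exists B, 0 < B /\
  forall F a, family_bound F a -> cmod (\det (coord_mx l F)) <= B * \prod_i a i.
Proof.
move=> lr; have [k hk] := qbnd lr.
exists (\sum_(s : {perm 'I_n}) `|k| ^+ n + 1); split.
  by rewrite ltr_wpDl// sumr_ge0// => i _; rewrite exprn_ge0.
move=> G a Ga; have a0 : 0 <= \prod_i a i.
  by apply: prodr_ge0 => i _; have [/ltW] := Ga i.
rewrite mulrDl mul1r mulr_suml (le_trans (cmod_sum _))//.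
rewrite -[leLHS]addr0 lerD//; apply: ler_sum => s _.
rewrite cmodM cmod_prod.
have -> : cmod ((-1) ^+ s : C) = 1.
  by case: (s : bool); rewrite ?expr0 ?expr1 ?cmodN cmod1.
rewrite mul1r -[n in _ ^+ n]card_ord -prodr_const -big_split /=.
apply: ler_prod => i _; rewrite cmod_ge0 mxE /=.
have [ai bi] := Ga i; apply: le_trans (hk _ _ bi _) _.
by rewrite ler_wpM2r ?ler_norm// ltW.
Qed.

Definition bounded_family F := exists a, family_bound F a.

Variable h : R.
Hypotheses (h0 : 0 < h) (hsmall : 2 * h * (Cd * n%:R) <= 1).

(** The zeros within h of l0 are removed one by one.  Each removal multiplies
|det| at l0 by at least 1 / h and the product of the bounds by Cd n, hence at
least doubles their quotient, which is at most B. *)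
Lemma clear_around l0 F : cmod l0 <= rho -> bounded_family F -> good F l0 ->
  exists F', [/\ bounded_family F',
    forall l, cmod l <= rho -> good F l -> good F' l
  & forall l, cmod l <= rho -> cmod (l - l0) <= h -> good F' l].
Proof.
move=> l0r [a Fa] gF.
have [B [B0 hB]] := coord_det_bound l0r.
pose D G := cmod (\det (coord_mx l0 G)).
(* N bounds the number of removals that are still possible. *)
have [N] : exists N : nat, B * \prod_i a i < 2 ^+ N * D F.
  have DF : 0 < D F by rewrite cmod_gt0.
  have a0 : 0 < B * \prod_i a i.
    by rewrite mulr_gt0// prodr_gt0// => i _; have [] := Fa i.
  have [k hk] := half_pow_small (B * \prod_i a i) (divr_gt0 DF (ltr0Sn R 1)).
  exists k; move: hk; rewrite ler_pdivrMr ?exprn_gt0//.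
  by move/le_lt_trans; apply; rewrite mulrC ltr_pM2l ?exprn_gt0//; lra.
elim: N F a Fa gF => [|N IH] F a Fa gF.
  by rewrite expr0 mul1r ltNge hB.
move=> ha; have [Hg|Hb] := pselect (forall l, cmod l <= rho ->
    cmod (l - l0) <= h -> good F l).
  by exists F; split=> //; exists a.
have [l1 [l1r l10 l1b]] : exists l1, [/\ cmod l1 <= rho, cmod (l1 - l0) <= h
    & \det (coord_mx l1 F) = 0].
  apply: contrapT => Hn; apply: Hb => l lr ll0; apply/negP => /eqP dl.
  by apply: Hn; exists l.
have [F' [a' [Fa' pa' hF']]] := remove_zero l1r Fa l1b.
have gF' l : cmod l <= rho -> good F l -> good F' l.
  by move=> lr; rewrite /good (hF' l lr) mulf_eq0 negb_or => /andP[].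
have [|G [bG gG hG]] := IH F' a' Fa' (gF' _ l0r gF).
  have DE : D F <= h * D F'.
    rewrite /D (hF' _ l0r) cmodM ler_wpM2r ?cmod_ge0//.
    by rewrite -cmodN opprB.
  rewrite pa' -(ltr_pM2l h0) mulrA.
  have Q0 : 0 <= B * \prod_i a i.
    by rewrite ltW// mulr_gt0// prodr_gt0// => i _; have [] := Fa i.
  have h1 : 2 * (h * B * (Cd * n%:R * \prod_i a i)) <= B * \prod_i a i.
    have -> : 2 * (h * B * (Cd * n%:R * \prod_i a i)) =
      (2 * h * (Cd * n%:R)) * (B * \prod_i a i) by ring.
    by rewrite -[leRHS]mul1r ler_wpM2r.
  have h2 : 2 ^+ N * D F <= 2 ^+ N * (h * D F') by rewrite ler_wpM2l// exprn_ge0.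
  move: ha; rewrite exprS => ha.
  have -> : h * (2 ^+ N * D F') = 2 ^+ N * (h * D F') by ring.
  by move: h1 h2 ha; rewrite -!mulrA; lra.
by exists G; split=> // l lr /(gF' l lr); exact: gG.
Qed.

(** A family good at 0 is improved along rays from 0 in steps of length h, one
ray for each point of a finite h-net; what is good stays good. *)
Theorem steering F : bounded_family F -> good F 0 -> 0 <= rho ->
  exists F', bounded_family F' /\ forall l, cmod l <= rho -> good F' l.
Proof.
move=> bF gF rho0.
have step p : cmod p <= rho -> forall F, bounded_family F -> good F 0 ->
    exists F', [/\ bounded_family F',
      forall l, cmod l <= rho -> good F l -> good F' l
    & forall l, cmod l <= rho -> cmod (l - p) <= h -> good F' l].
  move: p; apply: (@ray_induction _ _ rho h h0).
    by move=> G bG g0; apply: clear_around => //; rewrite cmod0.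
  move=> l l' lr l'r ll' IH G bG g0.
  have [G1 [bG1 gG1 hG1]] := IH G bG g0.
  have [G2 [bG2 gG2 hG2]] := clear_around l'r bG1 (hG1 _ l'r ll').
  by exists G2; split=> // k kr /(gG1 _ kr); exact: gG2.
have [s [sr hs]] := disc_net rho h0.
suff [G [bG _ hG]] : exists G, [/\ bounded_family G, good G 0 &
    forall p, p \in s -> forall l, cmod l <= rho -> cmod (l - p) <= h -> good G l].
  by exists G; split=> // l lr; have [p ps lp] := hs l lr; exact: hG ps _ lr lp.
elim: s sr {hs} => [|p s IH] sr; first by exists F; split.
have [|G [bG g0 hG]] := IH.
  by move=> p' p's; apply: sr; rewrite inE p's orbT.
have [G' [bG' gG' hG']] := step p (sr p (mem_head _ _)) G bG g0.
exists G'; split=> //; first by apply: gG'; rewrite ?cmod0.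
move=> p'; rewrite inE => /orP[/eqP -> //|p's] l lr lp.
by apply: gG' => //; exact: hG lp.
Qed.

End Steering.

(** * Common complements on a disc *)
Section CommonComplements.
Variables (R : realType) (X Y : completeNormedModType R[i]).
Local Notation C := (R[i]).

(** Coordinates modulo the range of T.  They are continuous because they are part
of the inverse of a bordered operator. *)
Lemma cokernel_coordinates (T : {linear X -> Y}) M n m (v : 'I_n -> X) (y : 'I_m -> Y) :
  opbound T M ->
  quotient_basis (null_space T) [set 0] v ->
  quotient_basis [set: Y] (range T) y ->
  exists q : Y -> 'rV[C]_m, [/\ linear q,
    forall z (c : 'rV[C]_m), range T (z - \sum_i c 0 i *: y i) <-> q z = c
  & exists k, 0 <= k /\ forall z i, cmod (q z 0 i) <= k * rnorm z].
Proof.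
move=> bT hv hy.
have [|f [fb fv]] := dual_functionals (v := v).
  have U0 : null_space T 0 by exact: linear0.
  exact: kernel_basis_free U0 hv.
have fu : \matrix_(i, j) f i (v j) \in unitmx.
  suff -> : \matrix_(i, j) f i (v j) = 1%:M by exact: unitmx1.
  by apply/matrixP => i j; rewrite !mxE fv.
have [k hk] := quotient_coordinates_bounded bT hv hy fb fu.
have /choice[q hq] z : exists c : 'rV[C]_m, range T (z - \sum_i c 0 i *: y i).
  by have [c [hc _]] := hy.2 z I; exists c.
have qE z (c : 'rV[C]_m) : range T (z - \sum_i c 0 i *: y i) <-> q z = c.
  split=> [hc|<- //]; have [d [_ du]] := hy.2 z I.
  by rewrite -(du _ hc) (du _ (hq z)).
exists q; split=> //.
  move=> a z w; apply/qE.
  have -> : a *: z + w - \sum_i (a *: q z + q w) 0 i *: y i =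
      a *: (z - \sum_i q z 0 i *: y i) + (w - \sum_i q w 0 i *: y i).
    rewrite scalerBr addrACA -opprD; congr (_ - _).
    rewrite scaler_sumr -big_split; apply: eq_bigr => i _.
    by rewrite !mxE scalerDl scalerA.
  exact: range_linear.
exists `|k|; split=> // z i; apply: le_trans (hk z _ (hq z) i) _.
by rewrite ler_wpM2r ?ler_norm// (norm_nonneg (@rnorm_is_norm _ _)).
Qed.

Variables (T S : {linear X -> Y}) (t s : R).
Hypothesis bT : opbound T t.
Hypotheses (s0 : 0 <= s) (bS : opbound S s).
Variables (n m : nat) (r : R).
Hypothesis kerT : forall l, cmod l < r -> exists v : 'I_n -> X,
  quotient_basis (null_space (pencil T S l)) [set 0] v.
Hypothesis cokerT : forall l, cmod l < r -> exists y : 'I_m -> Y,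
  quotient_basis [set: Y] (range (pencil T S l)) y.
Variable rho : R.
Hypotheses (rho0 : 0 <= rho) (rhor : rho < r).

(** Steering functionals modulo those which vanish on ker T_l.  If f kills
ker T_l1 and L is an inner inverse of T_l1, then f = f L T_l1, and on ker T_l
this is (l - l1) f L S. *)
Lemma common_functionals (v : C -> 'I_n -> X) :
  (forall l, cmod l < r ->
     quotient_basis (null_space (pencil T S l)) [set 0] (v l)) ->
  exists f : 'I_n -> X -> C, (forall i, exists K, functional (f i) K) /\
    forall l, cmod l <= rho -> \matrix_(i, j) f i (v l j) \in unitmx.
Proof.
move=> hv; have [c c0 hL] := uniform_inner_inverse bT s0 bS kerT cokerT rhor.
have nX := @rnorm_is_norm _ X; have nY := @rnorm_is_norm _ Y.
pose V : lmodType C := (X -> C^o)%type.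
pose bnd (f : V) a := 0 <= a /\ functional (f : X -> C) a.
pose q l (f : V) : 'rV[C]_n := \row_j f (v l j).
(* The 1 makes the constant positive even for S = 0. *)
pose Cd := c * (s + 1).
have Cd0 : 0 < Cd by rewrite mulr_gt0// ltr_wpDl.
pose h := (2 * (Cd * n.+1%:R))^-1.
have h0 : 0 < h by rewrite invr_gt0 mulr_gt0// mulr_gt0// ltr0n.
have hsmall : 2 * h * (Cd * n%:R) <= 1.
  apply: (@le_trans _ _ (2 * h * (Cd * n.+1%:R))).
    by rewrite ler_wpM2l ?mulr_ge0 ?(ltW h0)// ler_wpM2l ?(ltW Cd0)// ler_nat.
  by rewrite /h mulrAC mulfV// gt_eqF// mulr_gt0// mulr_gt0// ltr0n.
have bndD (f g : V) a b : bnd f a -> bnd g b -> bnd (f + g) (a + b).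
  move=> [a0 fa] [b0 gb]; split; first exact: addr_ge0.
  have := functional_lincomb 1 fa gb; rewrite cmod1 mul1r.
  by congr functional; apply/funext => x; rewrite mul1r.
have bndZ a (f : V) b : bnd f b -> bnd (a *: f) (cmod a * b).
  move=> [b0 fb]; split; first by rewrite mulr_ge0// cmod_ge0.
  split=> [e x y|x].
    by rewrite -[LHS]/(a * f (e *: x + y)) fb.1 mulrDr mulrCA.
  by rewrite cmodM -mulrA ler_wpM2l ?cmod_ge0 ?fb.2.
have bnd_le (f : V) a b : a <= b -> bnd f a -> bnd f b.
  move=> ab [a0 fa]; split; first exact: le_trans ab.
  split; first exact: fa.1.
  by move=> x; apply: le_trans (fa.2 x) _; rewrite ler_wpM2r// (norm_nonneg nX).
have qlin l : cmod l <= rho -> linear (q l).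
  by move=> _ a f g; apply/rowP => j; rewrite !mxE.
have qbnd l : cmod l <= rho -> exists k, forall (f : V) a, bnd f a ->
    forall i, cmod (q l f 0 i) <= k * a.
  move=> _; exists (\sum_j rnorm (v l j)) => f a [a0 fa] i.
  rewrite mxE; apply: le_trans (fa.2 _) _; rewrite mulrC ler_wpM2r//.
  by rewrite (bigD1 i)//= lerDl sumr_ge0// => j _; exact: (norm_nonneg nX).
have divide l1 (f : V) a : cmod l1 <= rho -> bnd f a -> q l1 f = 0 ->
    exists g, bnd g (Cd * a) /\
      forall l, cmod l <= rho -> q l f = (l - l1) *: q l g.
  move=> l1r [a0 fa] qf; have [L [bL hLl]] := hL l1 l1r.
  have fker x : pencil T S l1 x = 0 -> f x = 0.
    move=> Tx; have [e ->] := kernel_basis_span (hv _ (le_lt_trans l1r rhor)) Tx.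
    rewrite (functional_sum fa) big1// => i _.
    by have /rowP/(_ i) := qf; rewrite !mxE => ->; rewrite mulr0.
  have fE x : f x = f (L (pencil T S l1 x)).
    apply/eqP; rewrite -subr_eq0 -(functionalB fa) fker//.
    by rewrite linearB /= hLl subrr.
  exists (fun x => f (L (S x))); split.
    split; first by rewrite mulr_ge0// ltW.
    split=> [e x y|x]; first by rewrite (linearP S) (linearP L) fa.1.
    apply: le_trans (fa.2 _) _; rewrite [Cd * a]mulrC -mulrA ler_wpM2l//.
    apply: le_trans (bL _) _; rewrite -mulrA ler_wpM2l ?(ltW c0)//.
    by apply: le_trans (bS _) _; rewrite ler_wpM2r ?(norm_nonneg nX)// lerDl.
  move=> l lr; apply/rowP => j; rewrite !mxE fE.
  have Tv : pencil T S l (v l j) = 0 by exact: (hv _ (le_lt_trans lr rhor)).1.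
  have -> : pencil T S l1 (v l j) = (l - l1) *: S (v l j).
    move/eqP: Tv; rewrite /pencil subr_eq0 => /eqP ->.
    by rewrite -scalerBl.
  by rewrite linearZ /= (functionalZ fa).
have r0 : cmod (0 : C) < r by rewrite cmod0 (le_lt_trans rho0).
have [|f0 [f0b f0v]] := dual_functionals (v := v 0).
  have U0 : null_space (pencil T S 0) 0 by exact: linear0.
  exact: kernel_basis_free U0 (hv _ r0).
have [||f [[a fa] fgood]] := steering bndD bndZ bnd_le qlin qbnd Cd0 divide
    h0 hsmall (F := f0) _ _ rho0.
- have [K hK] := choice f0b; exists (fun i => `|K i| + 1) => i; split.
    by rewrite ltr_wpDl.
  apply: (bnd_le _ `|K i|); first by rewrite lerDl.
  by split=> //; exact: functional_bound_abs.
- rewrite /good (_ : coord_mx _ _ _ = 1%:M) ?det1 ?oner_neq0//.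
  by apply/matrixP => i j; rewrite !mxE f0v.
exists f; split=> [i|l lr]; first by exists (a i); have [_ []] := fa i.
rewrite unitmxE unitfE; have := fgood l lr; rewrite /good.
by congr (\det _ != 0); apply/matrixP => i j; rewrite !mxE.
Qed.

(** Steering vectors modulo ran T_l.  A vector x of ran T_l1 is T_l1 L x for an
inner inverse L of T_l1, hence congruent to (l - l1) S L x modulo ran T_l. *)
Lemma common_complement : exists y : 'I_m -> Y,
  forall l, cmod l <= rho -> quotient_basis [set: Y] (range (pencil T S l)) y.
Proof.
have [c c0 hL] := uniform_inner_inverse bT s0 bS kerT cokerT rhor.
have nX := @rnorm_is_norm _ X; have nY := @rnorm_is_norm _ Y.
have /choice[q hq] l : exists q : Y -> 'rV[C]_m, cmod l < r ->
    [/\ linear q,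
      exists y : 'I_m -> Y, forall z (c : 'rV[C]_m),
        range (pencil T S l) (z - \sum_i c 0 i *: y i) <-> q z = c
    & exists k, 0 <= k /\ forall z i, cmod (q z 0 i) <= k * rnorm z].
  have [lr|_] := boolP (cmod l < r); last by exists (fun=> 0).
  have [v hv] := kerT lr; have [y hy] := cokerT lr.
  have [q [q1 q2 q3]] := cokernel_coordinates (pencil_bounded bT bS l) hv hy.
  by exists q => _; split=> //; exists y.
have q0 l z : cmod l < r -> range (pencil T S l) z <-> q l z = 0.
  move=> lr; have [_ [y hy] _] := hq l lr; rewrite -hy big1 ?subr0// => i _.
  by rewrite mxE scale0r.
pose bnd (z : Y) a := 0 <= a /\ rnorm z <= a.
pose Cd := c * (s + 1).
have Cd0 : 0 < Cd by rewrite mulr_gt0// ltr_wpDl.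
pose h := (2 * (Cd * m.+1%:R))^-1.
have h0 : 0 < h by rewrite invr_gt0 mulr_gt0// mulr_gt0// ltr0n.
have hsmall : 2 * h * (Cd * m%:R) <= 1.
  apply: (@le_trans _ _ (2 * h * (Cd * m.+1%:R))).
    by rewrite ler_wpM2l ?mulr_ge0 ?(ltW h0)// ler_wpM2l ?(ltW Cd0)// ler_nat.
  by rewrite /h mulrAC mulfV// gt_eqF// mulr_gt0// mulr_gt0// ltr0n.
have bndD x y a b : bnd x a -> bnd y b -> bnd (x + y) (a + b).
  move=> [a0 xa] [b0 yb]; split; first exact: addr_ge0.
  by apply: le_trans (norm_triangle nY _ _) _; exact: lerD.
have bndZ e x a : bnd x a -> bnd (e *: x) (cmod e * a).
  move=> [a0 xa]; split; first by rewrite mulr_ge0// cmod_ge0.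
  by rewrite (norm_scale nY) ler_wpM2l ?cmod_ge0.
have bnd_le x a b : a <= b -> bnd x a -> bnd x b.
  by move=> ab [a0 xa]; split; exact: le_trans ab.
have lrr l : cmod l <= rho -> cmod l < r by move=> lr; exact: le_lt_trans rhor.
have qlin l : cmod l <= rho -> linear (q l).
  by move=> /lrr lr; have [] := hq l lr.
have qbnd l : cmod l <= rho -> exists k, forall x a, bnd x a ->
    forall i, cmod (q l x 0 i) <= k * a.
  move=> /lrr lr; have [_ _ [k [k0 hk]]] := hq l lr.
  exists k => x a [_ xa] i; apply: le_trans (hk _ _) _.
  by rewrite ler_wpM2l.
have divide l1 x a : cmod l1 <= rho -> bnd x a -> q l1 x = 0 ->
    exists y, bnd y (Cd * a) /\
      forall l, cmod l <= rho -> q l x = (l - l1) *: q l y.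
  move=> l1r [a0 xa] /(q0 _ _ (lrr _ l1r))[u _ uE].
  have [L [bL hLl]] := hL l1 l1r.
  exists (S (L x)); split.
    split; first by rewrite mulr_ge0// ltW.
    apply: le_trans (bS _) _; apply: (@le_trans _ _ (s * (c * a))).
      by rewrite ler_wpM2l// (le_trans (bL _))// ler_wpM2l// ltW.
    rewrite /Cd mulrA [s * c]mulrC ler_wpM2r// ler_wpM2l ?(ltW c0)//.
    by rewrite lerDl.
  move=> l lr; have [f fE] := linear_fun_of (qlin l lr).
  apply/eqP; rewrite -subr_eq0 -!fE -linearZ -linearB fE; apply/eqP.
  apply/(q0 _ _ (lrr _ lr)); exists (L x) => //.
  have {2}-> : x = pencil T S l1 (L x) by rewrite -uE hLl.
  by rewrite /pencil scalerBl opprB addrA subrK.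
have l0 : cmod (0 : C) <= rho by rewrite cmod0.
have [_ [y0 hy0] _] := hq _ (lrr _ l0).
have [||ys [[a ysa] ygood]] := steering bndD bndZ bnd_le qlin qbnd Cd0 divide
    h0 hsmall (F := y0) _ _ rho0.
- exists (fun i => rnorm (y0 i) + 1) => i; split; first by rewrite ltr_wpDl ?(norm_nonneg nY).
  by split; [rewrite addr_ge0 ?(norm_nonneg nY) | rewrite lerDl].
- rewrite /good (_ : coord_mx _ _ _ = 1%:M) ?det1 ?oner_neq0//.
  apply/matrixP => i j; rewrite !mxE.
  have -> : q 0 (y0 i) = delta_mx 0 i.
    apply/hy0; rewrite (bigD1 i)//= mxE !eqxx scale1r big1 ?addr0.
      by rewrite subrr; exists 0; rewrite ?linear0.
    by move=> k ki; rewrite mxE (negbTE ki) andbF scale0r.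
  by rewrite mxE eqxx eq_sym.
exists ys => l lr; split=> // z _.
have [f fE] := linear_fun_of (qlin l lr).
pose G := coord_mx q l ys.
have Gu : G \in unitmx by rewrite unitmxE unitfE; exact: ygood.
have key (e : 'rV[C]_m) :
    range (pencil T S l) (z - \sum_i e 0 i *: ys i) <-> q l z = e *m G.
  rewrite (q0 _ _ (lrr _ lr)) -fE linearB linear_sum /=.
  have -> : \sum_i f (e 0 i *: ys i) = e *m G.
    apply/rowP => j; rewrite mxE summxE; apply: eq_bigr => i _.
    by rewrite linearZ fE !mxE.
  by rewrite fE; split=> [/eqP|->]; rewrite ?subrr// subr_eq0 => /eqP.
exists (q l z *m invmx G); split; first by apply/key; rewrite mulmxKV.
by move=> e /key ->; rewrite mulmxK.
Qed.

End CommonComplements.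

(** * A generalized inverse with large resolvent disc *)
Section SteeredInverse.
Variables (R : realType) (X Y : completeNormedModType R[i]).
Local Notation C := (R[i]).
Variables (T S : {linear X -> Y}) (t s : R).
Hypothesis bT : opbound T t.
Hypotheses (s0 : 0 <= s) (bS : opbound S s).
Variables (n m : nat) (r : R).
Hypothesis kerT : forall l, cmod l < r -> exists v : 'I_n -> X,
  quotient_basis (null_space (pencil T S l)) [set 0] v.
Hypothesis cokerT : forall l, cmod l < r -> exists y : 'I_m -> Y,
  quotient_basis [set: Y] (range (pencil T S l)) y.
Variable rho : R.
Hypotheses (rho0 : 0 <= rho) (rhor : rho < r).

Lemma inverse_family : exists (f : 'I_n -> X -> C) (y : 'I_m -> Y),
  forall l, cmod l <= rho -> exists L : {linear Y -> X},
  [/\ exists B, opbound L B,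
      forall x, (forall i, f i x = 0) -> L (pencil T S l x) = x,
      forall i, L (y i) = 0,
      forall z, exists c : 'I_m -> C, pencil T S l (L z) = z - \sum_i c i *: y i
    & forall z i, f i (L z) = 0] /\
  forall x, pencil T S l (L (pencil T S l x)) = pencil T S l x.
Proof.
have /choice[v hv] l : exists v : 'I_n -> X, cmod l < r ->
    quotient_basis (null_space (pencil T S l)) [set 0] v.
  have [lr|_] := boolP (cmod l < r); last by exists (fun=> 0).
  by have [v hv] := kerT lr; exists v.
have [f [fb fu]] := common_functionals bT s0 bS kerT cokerT rho0 rhor hv.
have [y hy] := common_complement bT s0 bS kerT cokerT rho0 rhor.
exists f, y => l lr; have lr' := le_lt_trans lr rhor.
have [L hL] := bordered_inverse (pencil_bounded bT bS l) (hv l lr') (hy l lr) fb (fu l lr).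
exists L; split=> // x; have [_ LT _ _ _] := hL.
exact: (inner_inverse_of_left (hv l lr') fb (fu l lr) LT).
Qed.

(** L is the member at 0 of the family L_l.  Since both share f and y, applying
one of L, L_l to the equation solved by the other gives
L_l (z - l S L z) = L z and L (z + l S L_l z) = L_l z, and so I + l S L_l
inverts I - l S L. *)
Theorem steered_inverse : exists L : {linear Y -> X},
  [/\ exists B, opbound L B,
      forall x, T (L (T x)) = T x, forall z, L (T (L z)) = L z
    & forall l, cmod l <= rho -> exists2 Q : {linear Y -> Y},
        is_resolvent (S \o L) l Q & exists B, opbound Q B].
Proof.
have [f [y hfy]] := inverse_family.
have [L [[bL LT Ly TL fL] TLT]] : exists L : {linear Y -> X},
  [/\ exists B, opbound L B,
      forall x, (forall i, f i x = 0) -> L (T x) = x,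
      forall i, L (y i) = 0,
      forall z, exists c : 'I_m -> C, T (L z) = z - \sum_i c i *: y i
    & forall z i, f i (L z) = 0] /\
  forall x, T (L (T x)) = T x.
  by have := hfy 0; rewrite pencil0; apply; rewrite cmod0.
exists L; split=> // [z|l lr]; first exact/LT/fL.
have [Ll [[[B bLl] LTl Lyl TLl fLl] _]] := hfy l lr.
have sum0 (G : {linear Y -> X}) (c : 'I_m -> C) : (forall i, G (y i) = 0) ->
    G (\sum_i c i *: y i) = 0.
  move=> Gy; rewrite linear_sum big1// => i _.
  by rewrite linearZ /= Gy scaler0.
have e1 z : Ll (z - l *: S (L z)) = L z.
  have [c cE] := TL z; rewrite -[RHS](LTl (L z) (fL z)) /pencil cE addrAC.
  by rewrite [RHS]linearB /= sum0// subr0.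
have e2 z : L (z + l *: S (Ll z)) = Ll z.
  have [c cE] := TLl z; rewrite -[RHS](LT (Ll z) (fLl z)).
  have -> : T (Ll z) = z + l *: S (Ll z) - \sum_i c i *: y i.
    by rewrite addrAC -cE /pencil subrK.
  by rewrite [RHS]linearB /= sum0// subr0.
have lQ : linear (fun z => z + l *: S (Ll z)).
  move=> a z w; rewrite (linearP Ll) (linearP S) !scalerDr !scalerA addrACA.
  by rewrite [l * a]mulrC.
have [Q QE] := linear_fun_of lQ.
exists Q; first by split=> z /=; rewrite !QE ?e1 ?e2 ?subrK ?addrK.
exists (1 + cmod l * (s * B)) => z; rewrite QE mulrDl mul1r.
have nY := @rnorm_is_norm _ Y; apply: le_trans (norm_triangle nY _ _) _.
rewrite lerD2l (norm_scale nY) -mulrA ler_wpM2l ?cmod_ge0//.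
exact: (opb_comp s0 bLl bS).
Qed.

End SteeredInverse.

(** * Spectral radius and stability radius *)
Section ExtendedReals.
Variable R : realType.
Local Open Scope ereal_scope.

Lemma nnsup_ge0 (A : set (\bar R)) : 0 <= nnsup A.
Proof. by rewrite /nnsup le_max lexx. Qed.

Lemma nnsup_ub (A : set (\bar R)) x : A x -> x <= nnsup A.
Proof. by move=> Ax; rewrite /nnsup le_max ereal_sup_ubound ?orbT. Qed.

Lemma nnsup_le (A : set (\bar R)) x : 0 <= x -> (forall y, A y -> y <= x) ->
  nnsup A <= x.
Proof.
move=> x0 Ax; rewrite /nnsup ge_max x0 /=.
by apply: ge_ereal_sup => y /Ax.
Qed.

Lemma ereal_between (x y : \bar R) : 0 <= x -> x < y ->
  exists r : R, [/\ (0 < r)%R, x < r%:E & r%:E < y].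
Proof.
case: x => [x| |]; rewrite ?lee_fin => x0 //; last by rewrite ltNge leey.
case: y => [y| |//].
  rewrite lte_fin => xy; exists ((x + y) / 2)%R; rewrite !lte_fin.
  by split; lra.
by move=> _; exists (x + 1)%R; rewrite lte_fin ltry; split=> //; lra.
Qed.

End ExtendedReals.

Section SpectralRadius.
Variables (R : realType) (Y : completeNormedModType R[i]).
Local Notation C := (R[i]).
Variable A : {linear Y -> Y}.

(** For l <> 0 the number 1 / l is too large to be in the spectrum, and
I - l A = l (1 / l - A). *)
Lemma resolvent_of_spectral_radius (rho : R) : 0 < rho ->
  (rho%:E < (spectral_radius A)^-1)%E ->
  forall l, cmod l <= rho -> exists2 Q : {linear Y -> Y},
    is_resolvent A l Q & exists B, opbound Q B.
Proof.
move=> rho0 hrho l lr.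
have [->|l0] := eqVneq l 0.
  exists [the {linear Y -> Y} of idfun]; last by exists 1 => y; rewrite mul1r.
  by split=> y /=; rewrite scale0r subr0.
have sp : ~ spectrum A l^-1.
  move=> sl; have : ((cmod l^-1)%:E <= spectral_radius A)%E.
    by apply: nnsup_ub; exists l^-1.
  rewrite leNgt => /negP; apply.
  have : ((spectral_radius A) < (rho^-1)%:E)%E.
    move: hrho; rewrite inve_pgt ?inE ?lee_fin ?(ltW rho0) ?nnsup_ge0//.
    by rewrite inver gt_eqF.
  move=> /lt_le_trans; apply; rewrite lee_fin cmodV lef_pV2 ?posrE ?cmod_gt0//.
have /contrapT[B [/bounded_opP[M bB] B1 B2]] := sp.
have lQ : linear (fun y => l^-1 *: B y).
  by move=> a x y; rewrite linearP scalerDr !scalerA [_ * a]mulrC.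
have [Q QE] := linear_fun_of lQ.
have lE y : y - l *: A y = l *: (l^-1 *: y - A y).
  by rewrite scalerBr scalerA mulfV// scale1r.
have AZ a y : A (a *: y) = a *: A y by rewrite linearZ.
have BZ a y : B (a *: y) = a *: B y by rewrite linearZ.
exists Q; first split=> y.
- by rewrite lE QE BZ B1 scalerA mulVf// scale1r.
- by rewrite QE AZ scalerA mulfV// scale1r B2.
exists (cmod l^-1 * M) => y; rewrite QE (norm_scale (@rnorm_is_norm _ Y)) -mulrA.
by rewrite ler_wpM2l ?cmod_ge0.
Qed.

Lemma spectral_radius_of_resolvent (rho : R) : 0 < rho ->
  (forall l, cmod l <= rho -> exists2 Q : {linear Y -> Y},
    is_resolvent A l Q & exists B, opbound Q B) ->
  (rho%:E <= (spectral_radius A)^-1)%E.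
Proof.
move=> rho0 hres.
suff : (spectral_radius A <= (rho^-1)%:E)%E.
  by rewrite inve_pge ?inE ?lee_fin ?(ltW rho0) ?nnsup_ge0// inver gt_eqF.
apply: nnsup_le => [|_ [l sl <-]]; first by rewrite lee_fin invr_ge0 ltW.
rewrite lee_fin leNgt; apply/negP => lr; apply: sl.
have l0 : l != 0.
  by apply/eqP => l0; move: lr; rewrite l0 cmod0 ltNge invr_ge0 ltW.
have [|Q [Q1 Q2] [M bQ]] := hres l^-1.
  by rewrite cmodV -[leRHS]invrK lef_pV2 ?posrE ?invr_gt0 ?cmod_gt0// ltW.
have lB : linear (fun y => l^-1 *: Q y).
  by move=> a x y; rewrite linearP scalerDr !scalerA [_ * a]mulrC.
have [B BE] := linear_fun_of lB.
have lE y : l *: y - A y = l *: (y - l^-1 *: A y).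
  by rewrite scalerBr scalerA mulfV// scale1r.
have AZ a y : A (a *: y) = a *: A y by rewrite linearZ.
have QZ a y : Q (a *: y) = a *: Q y by rewrite linearZ.
exists B; split=> [|y|y].
- apply/bounded_opP; exists (cmod l^-1 * M) => y.
  by rewrite BE (norm_scale (@rnorm_is_norm _ Y)) -mulrA ler_wpM2l ?cmod_ge0.
- by rewrite BE lE QZ Q1 scalerA mulVf// scale1r.
- by rewrite BE AZ scalerA mulfV// scale1r Q2.
Qed.

End SpectralRadius.

Section StabilityRadius.
Variables (R : realType) (X Y : completeNormedModType R[i]).
Variables (T S : {linear X -> Y}) (t s : R).
Hypotheses (t0 : 0 <= t) (bT : opbound T t).
Hypotheses (s0 : 0 <= s) (bS : opbound S s).
Variables (n m : nat).
Hypothesis kerT : space_dim (null_space T) = Some n.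
Hypothesis cokerT : space_codim (range T) = Some m.

Lemma constant_kernel_basis (r : R) : 0 < r ->
  constant_on (disc r) (fun l => space_dim (null_space (pencil T S l))) ->
  forall l, cmod l < r -> exists v : 'I_n -> X,
    quotient_basis (null_space (pencil T S l)) [set 0] v.
Proof.
move=> r0 hr l lr; have r00 : disc r 0 by rewrite /disc /mkset cmod0.
have := hr l 0 lr r00; rewrite /= pencil0 kerT; exact: quotient_dim_Some.
Qed.

Lemma constant_range_basis (r : R) : 0 < r ->
  constant_on (disc r) (fun l => space_codim (range (pencil T S l))) ->
  forall l, cmod l < r -> exists y : 'I_m -> Y,
    quotient_basis [set: Y] (range (pencil T S l)) y.
Proof.
move=> r0 hr l lr; have r00 : disc r 0 by rewrite /disc /mkset cmod0.
have := hr l 0 lr r00; rewrite /= pencil0 cokerT; exact: quotient_dim_Some.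
Qed.

(** Were the stability radius smaller, it would be smaller than some
rho < 1 / r(S L); but regularity holds on the disc of radius rho. *)
Lemma inner_inverse_le_stability (r : R) (L : {linear Y -> X}) : 0 < r ->
  constant_on (disc r) (fun l => space_dim (null_space (pencil T S l))) ->
  inner_inverse T L ->
  ((spectral_radius (S \o L))^-1 <= stability_radius T S)%E.
Proof.
move=> r0 hr [/bounded_opP[b /opb_absr bL] TLT].
have [v hv] := quotient_dim_Some kerT.
have [y hy] := quotient_dim_Some cokerT.
have hres := resolvent_of_spectral_radius (A := [the {linear Y -> Y} of S \o L]).
rewrite leNgt; apply/negP => /ereal_between[|rho [rho0 h1 h2]].
  exact: nnsup_ge0.
have {}hres := hres _ rho0 h2.
have reg := regular_on_disc t0 bT s0 bS (normr_ge0 b) bL TLT r0 hv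
  (constant_kernel_basis r0 hr) hres.
move: h1; rewrite ltNge => /negP; apply; apply: nnsup_ub; exists rho => //.
suff H l : cmod l < rho ->
    space_dim (null_space (pencil T S l)) = Some n /\
    space_codim (range (pencil T S l)) = Some m.
  by split=> // l l' /H[hl1 hl2] /H[hl'1 hl'2]; rewrite ?hl1 ?hl'1 ?hl2 ?hl'2.
move=> lr; have [Q hQ _] := hres l (ltW lr).
have {}reg := reg l Q (ltW lr) hQ; split.
  exact: kernel_dimE (pencil_kernel_basis TLT hQ reg hv).
have [y' hy'] := pencil_range_basis TLT hQ reg hy.
exact: range_codimE hy'.
Qed.

Lemma stability_le_reflexive_inverse :
  (stability_radius T S <=
   nnsup [set ((spectral_radius (S \o L))^-1)%E | L in reflexive_inverse T])%E.
Proof.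
apply: nnsup_le => [|_ [r [r0 hker hran] <-]]; first exact: nnsup_ge0.
rewrite leNgt; apply/negP => /ereal_between[|rho [rho0 h1 h2]].
  exact: nnsup_ge0.
have [L [[b bL] TLT LTL hres]] := steered_inverse bT s0 bS
  (constant_kernel_basis r0 hker) (constant_range_basis r0 hran) (ltW rho0) h2.
move: h1; rewrite ltNge => /negP; apply.
have := spectral_radius_of_resolvent (A := [the {linear Y -> Y} of S \o L]) rho0 hres.
move/le_trans; apply; apply: nnsup_ub; exists L => //.
by split=> //; split=> //; apply/bounded_opP; exists b.
Qed.

End StabilityRadius.

Theorem theorem5p1 (R : realType) (X Y : completeNormedModType R[i])
    (T S : {linear X -> Y})
    (bT : bounded_op T) (bS : bounded_op S)
    (fT : fredholm T)
    (dimT : exists2 r : R, 0 < r &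
       constant_on (disc r)
         (fun lambda => space_dim (null_space (pencil T S lambda)))) :
  stability_radius T S =
    nnsup [set ((spectral_radius (S \o L))^-1)%E | L in inner_inverse T] /\
  nnsup [set ((spectral_radius (S \o L))^-1)%E | L in inner_inverse T] =
    nnsup [set ((spectral_radius (S \o L))^-1)%E | L in reflexive_inverse T].
Proof.
move: bT bS => /bounded_opP[t /opb_absr bT] /bounded_opP[s /opb_absr bS].
have [r r0 hr] := dimT.
have [n kerT] : exists n, space_dim (null_space T) = Some n.
  by have [] := fT; case: space_dim => // n _ _; exists n.
have [m cokerT] : exists m, space_codim (range T) = Some m.
  by have [_] := fT; case: space_codim => // m _; exists m.
have le1 := stability_le_reflexive_inverse bT (normr_ge0 s) bS kerT cokerT.
have le2 : (nnsup [set ((spectral_radius (S \o L))^-1)%E | L in reflexive_inverse T] <=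
    nnsup [set ((spectral_radius (S \o L))^-1)%E | L in inner_inverse T])%E.
  apply: nnsup_le => [|_ [L [hL _] <-]]; first exact: nnsup_ge0.
  by apply: nnsup_ub; exists L.
have le3 : (nnsup [set ((spectral_radius (S \o L))^-1)%E | L in inner_inverse T] <=
    stability_radius T S)%E.
  apply: nnsup_le => [|_ [L hL <-]]; first exact: nnsup_ge0.
  exact: (inner_inverse_le_stability (normr_ge0 t) bT (normr_ge0 s) bS kerT cokerT r0 hr hL).
split; apply/eqP; rewrite eq_le.
  by rewrite (le_trans le1 le2).
by rewrite (le_trans le3 le1).
Qed.
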